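(* Let $x,y$ be real numbers with $\pi<x<y<2\pi$ and $x+2\pi>2y$. Then $$K_{x,y}=[x,y]\cup[2\pi,2x]\cup[2y,x+2\pi]\cup[y+2\pi,4\pi]\cup[2x+4\pi,2y+4\pi]$$ is an $H^2$-wavelet set.
   Context: The Fourier transform is $\hat f(\xi)=\int_{\mathbb{R}} f(x)e^{-i\xi x}\,dx$ (extended to $L^2(\mathbb{R})$ as usual). The Hardy space is $H^2(\mathbb{R})=\{f\in L^2(\mathbb{R}):\hat f(\xi)=0\text{ for a.e. }\xi\le 0\}$. A function $\psi\in H^2(\mathbb{R})$ is an $H^2$-wavelet if $\{\psi_{j,k}=2^{j/2}\psi(2^j\cdot-k):j,k\in\mathbb{Z}\}$ is an orthonormal basis of $H^2(\mathbb{R})$. A measurable set $K\subset\mathbb{R}^+=(0,\infty)$ is an $H^2$-wavelet set if there is an $H^2$-wavelet $\psi$ with $|\hat\psi|=\chi_K$ a.e. *)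

(* Defs.v *)
From HB Require Import structures.
From mathcomp Require Import all_boot all_order all_algebra.
From mathcomp Require Import complex.
From mathcomp Require Import all_classical all_reals all_analysis.

Set Implicit Arguments.
Unset Strict Implicit.
Unset Printing Implicit Defensive.
Import Order.TTheory GRing.Theory Num.Theory.
Import numFieldNormedType.Exports.

Local Open Scope classical_set_scope.
Local Open Scope ring_scope.
Local Open Scope complex_scope.

(* Elements of L^2(R) are represented by functions R -> R[i] that are
   Borel-measurable (the sigma-algebra carried by [lebesgue_measure]); they are
   never compared pointwise, only almost everywhere or in L^2-norm. *)

Definition cmeasurable (R : realType) (f : R -> R[i]) : Prop :=
  measurable_fun setT (fun x => complex.Re (f x)) /\
  measurable_fun setT (fun x => complex.Im (f x)).

(* [`|z|] lives in R[i]; [normc z] is the same modulus as an element of R. *)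
Definition L2norm (R : realType) (f : R -> R[i]) : \bar R :=
  ('N[@lebesgue_measure R]_2%:E[(fun x => (ComplexField.Normc.normc (f x))%:E)])%E.

Definition L2 (R : realType) : set (R -> R[i]) :=
  [set f | cmeasurable f /\ (L2norm f < +oo)%E].

Definition cintegrable (R : realType) (f : R -> R[i]) : Prop :=
  (@lebesgue_measure R).-integrable setT (fun x => (complex.Re (f x))%:E) /\
  (@lebesgue_measure R).-integrable setT (fun x => (complex.Im (f x))%:E).

Definition cintegral (R : realType) (f : R -> R[i]) : R[i] :=
  (\int[@lebesgue_measure R]_x complex.Re (f x)) +i* (\int[@lebesgue_measure R]_x complex.Im (f x)).

Definition inner (R : realType) (f g : R -> R[i]) : R[i] :=
  cintegral (fun x => f x * (g x)^*).

(* e^{it} *)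
Definition expi (R : realType) (t : R) : R[i] := cos t +i* sin t.

Definition fourier (R : realType) (f : R -> R[i]) (xi : R) : R[i] :=
  cintegral (fun x => f x * expi (- (xi * x))).

(* [fourierL2 f g]: g is (a representative of) the Fourier transform of the
   L^2 function f, i.e. the value at f of the continuous extension to L^2 of the
   integral transform on L^1 /\ L^2. By Plancherel, g exists, is independent of
   the approximating sequence, and is unique up to a null set. *)
Definition fourierL2 (R : realType) (f g : R -> R[i]) : Prop :=
  [/\ L2 f, L2 g &
    exists u : nat -> R -> R[i],
      [/\ forall n, cintegrable (u n) /\ L2 (u n),
          (fun n => L2norm (fun x => u n x - f x)) @ \oo --> 0%E &
          (fun n => L2norm (fun xi => fourier (u n) xi - g xi)) @ \oo --> 0%E]].

Definition H2 (R : realType) : set (R -> R[i]) :=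
  [set f | L2 f /\ exists g, fourierL2 f g /\
     {ae @lebesgue_measure R, forall xi : R, xi <= 0 -> g xi = 0}].

(* Orthonormal family of elements of H whose linear span is dense in H. *)
Definition orthonormal_basis (R : realType) (I : eqType)
    (H : set (R -> R[i])) (e : I -> R -> R[i]) : Prop :=
  [/\ forall i, H (e i),
      forall i j, inner (e i) (e j) = (i == j)%:R &
      forall f, H f -> forall eps : R, 0 < eps ->
        exists (s : seq I) (c : I -> R[i]),
          (L2norm (fun x => (f x - \sum_(i <- s) c i * e i x)%R) < eps%:E)%E].

Definition dilate (R : realType) (psi : R -> R[i]) (jk : int * int) (x : R)
    : R[i] :=
  (2 `^ (jk.1%:~R / 2))%:C * psi (2 ^ jk.1 * x - jk.2%:~R).

Definition H2_wavelet (R : realType) (psi : R -> R[i]) : Prop :=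
  H2 psi /\ orthonormal_basis (@H2 R) (dilate psi).

Definition H2_wavelet_set (R : realType) (K : set R) : Prop :=
  [/\ measurable K, K `<=` `]0, +oo[ &
    exists psi : R -> R[i], H2_wavelet psi /\
      exists g, fourierL2 psi g /\
        {ae @lebesgue_measure R, forall xi : R,
           ComplexField.Normc.normc (g xi) = \1_K xi}].

Definition Kset (R : realType) (x y : R) : set R :=
  `[x, y] `|` `[2 * pi, 2 * x] `|` `[2 * y, x + 2 * pi]
  `|` `[y + 2 * pi, 4 * pi] `|` `[2 * x + 4 * pi, 2 * y + 4 * pi].

(* Main.v *)
Require Import Defs.
From HB Require Import structures.
From mathcomp Require Import all_boot all_order all_algebra.
From mathcomp Require Import complex ring lra.
From mathcomp Require Import all_classical all_reals all_analysis measurable_realfun.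
Set Implicit Arguments.
Unset Strict Implicit.
Unset Printing Implicit Defensive.
Import Order.TTheory GRing.Theory Num.Theory.
Import numFieldNormedType.Exports.
Local Open Scope classical_set_scope.
Local Open Scope complex_scope.
Local Open Scope ring_scope.
Local Notation Re := complex.Re.
Local Notation Im := complex.Im.

(** Let K be [Kset x y]. Up to a null set, K meets every class modulo [2 * pi] exactly
    once, and its dilates by the powers of 2 are disjoint and fill the half-line.
    Let psi be the function with Fourier transform the indicator of K. The
    transform of psi_(j,k) is 2^(-j/2) e^(-i k 2^(-j) xi) on 2^j K and 0 elsewhere.
    By the translation property, the exponentials e^(i k xi) form an orthogonal
    basis of L2(K) ([Kh_orth], [Kh_separated], [in_span_exponentials]); rescaling
    gives bases of all L2(2^j K), and by the dilation property their union is an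
    orthogonal basis of L2 of the half-line ([wavelet_hat_orth],
    [wavelet_hat_complete]). The Plancherel identity transports it to the Hardy space.

    Completeness of the exponentials of period T on a bounded set E is proved directly on E.
    By a Dynkin class argument it is enough to expand the jump functions f, equal to
    1 on E to the left of a point and to 0 elsewhere. If t is a point of continuity
    of f on E, then g = (f - f(t)) / (e^(2 pi i (x - t) / T) - 1) is square-integrable
    provided that no other point of the closure of E is congruent to t. The Fourier
    coefficients of f - f(t) are differences of those of g, the series of f - f(t) at t
    telescopes, and its partial sums tend to 0 because the coefficients of g do
    (Bessel). So the partial sums for f converge a.e. to f; they also form a Cauchy
    sequence in L2, and Fatou's lemma identifies the limits.

    The same theorem on the interval from - c to c gives Parseval's identity there. Applied
    to e^(- i s x) f for f supported in the interval and integrated over s, it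
    becomes the Plancherel identity for f ([plancherel_compact]). Truncation extends
    it to functions that are both integrable and square-integrable
    ([plancherel_L1_L2]), and then to the pairs related by [fourierL2]. That the
    inverse Fourier integral of a boundedly supported G has transform G
    ([fourierL2_ift]) follows from Plancherel and the multiplication formula. *)

(** * Complex scalars *)

Section complex_scalars.
Variable R : realType.
Implicit Types (z w : R[i]) (t : R).

(** The squared modulus, as a real number. *)
Definition sq z : R := Re z ^+ 2 + Im z ^+ 2.

Lemma RecD z w : Re (z + w) = Re z + Re w. Proof. by case: z; case: w. Qed.
Lemma ImcD z w : Im (z + w) = Im z + Im w. Proof. by case: z; case: w. Qed.
Lemma RecN z : Re (- z) = - Re z. Proof. by case: z. Qed.
Lemma ImcN z : Im (- z) = - Im z. Proof. by case: z. Qed.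
Lemma RecM z w : Re (z * w) = Re z * Re w - Im z * Im w.
Proof. by case: z; case: w. Qed.
Lemma ImcM z w : Im (z * w) = Re z * Im w + Im z * Re w.
Proof. by case: z; case: w. Qed.
Lemma RecJ z : Re z^* = Re z. Proof. by case: z. Qed.
Lemma ImcJ z : Im z^* = - Im z. Proof. by case: z. Qed.
Lemma complex_ext z w : Re z = Re w -> Im z = Im w -> z = w.
Proof. by case: z => a b; case: w => c d /= -> ->. Qed.

Definition ReImE := (RecD, ImcD, RecN, ImcN, RecM, ImcM, RecJ, ImcJ).

Lemma RC_D (a b : R) : (a + b)%:C = a%:C + b%:C.
Proof. by apply: complex_ext; rewrite !ReImE /= ?addr0. Qed.
Lemma RC_N (a : R) : (- a)%:C = - a%:C.
Proof. by apply: complex_ext; rewrite !ReImE /= ?oppr0. Qed.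
Lemma RC_M (a b : R) : (a * b)%:C = a%:C * b%:C.
Proof. by apply: complex_ext; rewrite !ReImE /= ?mulr0 ?mul0r ?subr0 ?addr0. Qed.
Lemma RC_sum (I : Type) (s : seq I) (P : pred I) (F : I -> R) :
  (\sum_(i <- s | P i) F i)%:C = \sum_(i <- s | P i) (F i)%:C.
Proof. by elim/big_rec2: _ => // i y1 y2 _ <-; rewrite RC_D. Qed.
Lemma Re_sum (I : Type) (s : seq I) (P : pred I) (F : I -> R[i]) :
  Re (\sum_(i <- s | P i) F i) = \sum_(i <- s | P i) Re (F i).
Proof. by elim/big_rec2: _ => // i y1 y2 _ <-; rewrite RecD. Qed.
Lemma conjc_sum (I : Type) (s : seq I) (P : pred I) (F : I -> R[i]) :
  (\sum_(i <- s | P i) F i)^* = \sum_(i <- s | P i) (F i)^*.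
Proof.
elim/big_rec2: _ => [|i y1 y2 _ <-]; first exact: rmorph0.
by apply: complex_ext; rewrite !ReImE ?opprD.
Qed.
Lemma conjcM z w : (z * w)^* = z^* * w^*. Proof. exact: rmorphM. Qed.
Lemma conjc_conjc z : z^*^* = z. Proof. exact: conjCK. Qed.
Lemma conjcR (a : R) : (a%:C)^* = a%:C.
Proof. by apply: complex_ext; rewrite !ReImE //= oppr0. Qed.
Lemma conjcD z w : (z + w)^* = z^* + w^*. Proof. exact: rmorphD. Qed.

Lemma sq_ge0 z : 0 <= sq z.
Proof. by rewrite /sq addr_ge0// sqr_ge0. Qed.
Lemma sqM z w : sq (z * w) = sq z * sq w.
Proof. by rewrite /sq !ReImE; ring. Qed.
Lemma sqN z : sq (- z) = sq z.
Proof. by rewrite /sq !ReImE; ring. Qed.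
Lemma sqJ z : sq z^* = sq z.
Proof. by rewrite /sq !ReImE; ring. Qed.
Lemma sqC (a : R) : sq a%:C = a ^+ 2.
Proof. by rewrite /sq /=; ring. Qed.
Lemma sq0 : sq 0 = 0.
Proof. by rewrite /sq /= expr0n addr0. Qed.
Lemma sq1 : sq 1 = 1.
Proof. by rewrite /sq /= expr0n addr0 expr1n. Qed.
Lemma sq_eq0 z : sq z = 0 -> z = 0.
Proof.
move=> /eqP; rewrite /sq paddr_eq0 ?sqr_ge0// !sqrf_eq0 => /andP[/eqP a /eqP b].
exact: complex_ext.
Qed.
Lemma sqD_le z w : sq (z + w) <= 2 * sq z + 2 * sq w.
Proof.
rewrite /sq !ReImE -subr_ge0.
rewrite [leRHS](_ : _ = (Re z - Re w) ^+ 2 + (Im z - Im w) ^+ 2); last by ring.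
by rewrite addr_ge0 ?sqr_ge0.
Qed.
Lemma mulcJ z : z * z^* = (sq z)%:C.
Proof. by apply: complex_ext; rewrite !ReImE /sq /=; ring. Qed.
Lemma normc_sq z : ComplexField.Normc.normc z = Num.sqrt (sq z).
Proof. by case: z. Qed.
Lemma absRe_le z : `|Re z| ^+ 2 <= sq z.
Proof. by rewrite /sq real_normK ?num_real// lerDl sqr_ge0. Qed.
Lemma absIm_le z : `|Im z| ^+ 2 <= sq z.
Proof. by rewrite /sq real_normK ?num_real// lerDr sqr_ge0. Qed.

Lemma expiD (s t : R) : expi (s + t) = expi s * expi t.
Proof. by apply: complex_ext; rewrite !ReImE /= ?cosD ?sinD //; ring. Qed.
Lemma expi0 : expi (0 : R) = 1.
Proof. by apply: complex_ext; rewrite /= ?cos0 ?sin0. Qed.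
Lemma expiN t : expi (- t) = (expi t)^*.
Proof. by apply: complex_ext; rewrite /= ?cosN ?sinN. Qed.
Lemma sq_expi t : sq (expi t) = 1.
Proof. by rewrite /sq /= cos2Dsin2. Qed.
Lemma expi2pi_nat (n : nat) : expi (2 * pi * n%:R : R) = 1.
Proof.
elim: n => [|n IH]; first by rewrite mulr0 expi0.
rewrite -[n.+1]addn1 natrD mulrDr expiD IH mul1r mulr1.
by apply: complex_ext; rewrite /= mulr_natl ?cos2pi ?sin2pi.
Qed.
Lemma expi2pi (k : int) : expi (2 * pi * k%:~R : R) = 1.
Proof.
case: k => n; first by rewrite -pmulrn; exact: expi2pi_nat.
rewrite NegzE mulrNz -pmulrn mulrN expiN expi2pi_nat.
exact: rmorph1.
Qed.
End complex_scalars.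

(** * Integrals and square-integrable functions *)

Section complex_integral.
Variable R : realType.
Notation mu := (@lebesgue_measure R).
Implicit Types (f g : R -> R[i]) (c : R[i]).

Lemma integrable_EFinZ (k : R) (h : R -> R) :
  mu.-integrable setT (fun x => (h x)%:E) ->
  mu.-integrable setT (fun x => (k * h x)%:E).
Proof. by move=> jh; under eq_fun do rewrite EFinM; apply: integrableZl. Qed.

Lemma cmeasurable_cst c : cmeasurable (fun _ : R => c).
Proof. by split; exact: measurable_cst. Qed.
Lemma cmeasurableD f g : cmeasurable f -> cmeasurable g ->
  cmeasurable (fun x => f x + g x).
Proof.
move=> [rf jf] [rg jg]; split.
  by under eq_fun do rewrite RecD; exact: measurable_funD.
by under eq_fun do rewrite ImcD; exact: measurable_funD.
Qed.
Lemma cmeasurableN f : cmeasurable f -> cmeasurable (fun x => - f x).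
Proof.
move=> [rf jf]; split.
  by under eq_fun do rewrite RecN; exact: measurableT_comp.
by under eq_fun do rewrite ImcN; exact: measurableT_comp.
Qed.
Lemma cmeasurableB f g : cmeasurable f -> cmeasurable g ->
  cmeasurable (fun x => f x - g x).
Proof. by move=> mf mg; apply: cmeasurableD => //; exact: cmeasurableN. Qed.
Lemma cmeasurableM f g : cmeasurable f -> cmeasurable g ->
  cmeasurable (fun x => f x * g x).
Proof.
move=> [rf jf] [rg jg]; split.
  under eq_fun do rewrite RecM.
  by apply: measurable_funB; exact: measurable_funM.
under eq_fun do rewrite ImcM.
by apply: measurable_funD; exact: measurable_funM.
Qed.
Lemma cmeasurableJ f : cmeasurable f -> cmeasurable (fun x => (f x)^*).
Proof.
move=> [rf jf]; split; first by under eq_fun do rewrite RecJ.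
by under eq_fun do rewrite ImcJ; exact: measurableT_comp.
Qed.
Lemma cmeasurableC (h : R -> R) : measurable_fun setT h ->
  cmeasurable (fun x => (h x)%:C).
Proof. by move=> mh; split => //=; exact: measurable_cst. Qed.
Lemma cmeasurable_indic (A : set R) : measurable A ->
  cmeasurable (fun x => (\1_A x)%:C).
Proof. by move=> mA; apply: cmeasurableC; exact: measurable_indic. Qed.
Lemma cmeasurable_expi (h : R -> R) : measurable_fun setT h ->
  cmeasurable (fun x => expi (h x)).
Proof.
move=> mh; split => /=; apply: measurableT_comp => //;
  apply: continuous_measurable_fun; [exact: continuous_cos|exact: continuous_sin].
Qed.
Lemma measurable_sq f : cmeasurable f -> measurable_fun setT (fun x => sq (f x)).
Proof.
by move=> [rf jf]; apply: measurable_funD; exact: measurable_funX.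
Qed.

Lemma cintegrable_measurable f : cintegrable f -> cmeasurable f.
Proof.
move=> [rf jf]; split; apply/measurable_EFinP; exact: (measurable_int mu).
Qed.
(** Squares of moduli are compared, so that no square root has to be measured. *)
Lemma cintegrable_dominated f (h : R -> R) : cmeasurable f ->
  mu.-integrable setT (EFin \o h) -> (forall x, 0 <= h x) ->
  (forall x, sq (f x) <= h x ^+ 2) -> cintegrable f.
Proof.
move=> [rf jf] ih h0 fh; split; apply: (le_integrable _ _ _ ih) => //.
- exact/measurable_EFinP.
- move=> x _ /=; rewrite lee_fin (ger0_norm (h0 x)).
  by rewrite -ler_sqr ?nnegrE// (le_trans (absRe_le _)).
- exact/measurable_EFinP.
- move=> x _ /=; rewrite lee_fin (ger0_norm (h0 x)).
  by rewrite -ler_sqr ?nnegrE// (le_trans (absIm_le _)).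
Qed.
Lemma cintegrableD f g : cintegrable f -> cintegrable g ->
  cintegrable (fun x => f x + g x).
Proof.
move=> [rf jf] [rg jg]; split.
  by under eq_fun do rewrite RecD EFinD; apply: integrableD => //.
by under eq_fun do rewrite ImcD EFinD; apply: integrableD => //.
Qed.
Lemma cintegrableZ c f : cintegrable f -> cintegrable (fun x => c * f x).
Proof.
move=> [rf jf]; split.
  under eq_fun do rewrite RecM EFinB !EFinM.
  by apply: integrableB => //; apply: integrableZl => //.
under eq_fun do rewrite ImcM EFinD !EFinM.
by apply: integrableD => //; apply: integrableZl => //.
Qed.
Lemma cintegrableJ f : cintegrable f -> cintegrable (fun x => (f x)^*).
Proof.
move=> [rf jf]; split; first by under eq_fun do rewrite RecJ.
by under eq_fun do rewrite ImcJ EFinN; exact: integrableN.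
Qed.

Lemma cintegralD f g : cintegrable f -> cintegrable g ->
  cintegral (fun x => f x + g x) = cintegral f + cintegral g.
Proof.
move=> [rf jf] [rg jg]; apply: complex_ext; rewrite !ReImE /=.
  by under eq_Rintegral do rewrite RecD; rewrite RintegralD.
by under eq_Rintegral do rewrite ImcD; rewrite RintegralD.
Qed.
Lemma cintegralZ c f : cintegrable f ->
  cintegral (fun x => c * f x) = c * cintegral f.
Proof.
move=> [rf jf]; apply: complex_ext; rewrite !ReImE /=.
  under eq_Rintegral do rewrite RecM.
  by rewrite RintegralB ?RintegralZl//; exact: integrable_EFinZ.
under eq_Rintegral do rewrite ImcM.
by rewrite RintegralD ?RintegralZl//; exact: integrable_EFinZ.
Qed.
Lemma cintegralJ f : cintegrable f ->
  cintegral (fun x => (f x)^*) = (cintegral f)^*.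
Proof.
move=> [rf jf]; apply: complex_ext; rewrite !ReImE /=.
  by under eq_Rintegral do rewrite RecJ.
under eq_Rintegral do rewrite ImcJ -mulN1r.
by rewrite RintegralZl// mulN1r.
Qed.
Lemma cintegral_sum (I : Type) (s : seq I) (F : I -> R -> R[i]) :
  (forall i, cintegrable (F i)) ->
  cintegral (fun x => \sum_(i <- s) F i x) = \sum_(i <- s) cintegral (F i)
  /\ cintegrable (fun x => \sum_(i <- s) F i x).
Proof.
move=> mF; elim: s => [|i s [IH iF]].
  under eq_fun do rewrite big_nil; rewrite big_nil; split.
    by apply: complex_ext; rewrite /= /Rintegral integral0.
  by split; exact: integrable0.
under eq_fun do rewrite big_cons; rewrite big_cons -IH; split.
  by rewrite cintegralD.
exact: cintegrableD.
Qed.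
End complex_integral.

Section square_integrable.
Variable R : realType.
Notation mu := (@lebesgue_measure R).
Implicit Types (f g : R -> R[i]) (c : R[i]).

(** Membership in L2 and the squared L2 norm, with real values; [L2_sqint] and
    [L2norm_nrm2] relate them to [L2] and [L2norm]. *)
Definition sqint f := cmeasurable f /\
  mu.-integrable setT (fun x => (sq (f x))%:E).

Definition nrm2 f : R := \int[mu]_x sq (f x).

Lemma nrm2_ge0 f : 0 <= nrm2 f.
Proof. by apply: Rintegral_ge0 => x _; exact: sq_ge0. Qed.

Lemma nrm2_EFin f : sqint f -> (\int[mu]_x (sq (f x))%:E)%E = (nrm2 f)%:E.
Proof. by move=> [_ jf]; rewrite /nrm2 /Rintegral fineK// integrable_fin_num. Qed.

Lemma sqint_le f (h : R -> R) : cmeasurable f ->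
  mu.-integrable setT (EFin \o h) -> (forall x, sq (f x) <= h x) -> sqint f.
Proof.
move=> mf ih fh; split => //; apply: (le_integrable _ _ _ ih) => //.
  by apply/measurable_EFinP; exact: measurable_sq.
move=> x _ /=; rewrite lee_fin ger0_norm ?sq_ge0//.
exact: (le_trans (fh x) (ler_norm _)).
Qed.

Lemma sqint_dom f g : cmeasurable f -> sqint g ->
  (forall x, sq (f x) <= sq (g x)) -> sqint f.
Proof. by move=> mf [_ ig] fg; exact: sqint_le ig _. Qed.

Lemma nrm2_dom f g : cmeasurable f -> sqint g ->
  (forall x, sq (f x) <= sq (g x)) -> nrm2 f <= nrm2 g.
Proof.
move=> mf sg fg; apply: le_Rintegral => //; last by case: sg.
by case: (sqint_dom mf sg fg).
Qed.

Lemma sqintD f g : sqint f -> sqint g -> sqint (fun x => f x + g x).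
Proof.
move=> [mf jf] [mg jg].
apply: (@sqint_le _ (fun x => 2 * sq (f x) + 2 * sq (g x))).
- exact: cmeasurableD.
- rewrite (_ : _ \o _ = fun x => ((2 * sq (f x))%:E + (2 * sq (g x))%:E)%E)//.
  by apply: integrableD => //; under eq_fun do rewrite EFinM; apply: integrableZl => //.
- by move=> x; exact: sqD_le.
Qed.

Lemma sqintZ c f : sqint f -> sqint (fun x => c * f x).
Proof.
move=> [mf jf]; split; first by apply: cmeasurableM => //; exact: cmeasurable_cst.
by under eq_fun do rewrite sqM EFinM; apply: integrableZl => //.
Qed.
Lemma sqintN f : sqint f -> sqint (fun x => - f x).
Proof. by move=> /(@sqintZ (-1)); under eq_fun do rewrite mulN1r. Qed.
Lemma sqintB f g : sqint f -> sqint g -> sqint (fun x => f x - g x).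
Proof. by move=> jf jg; apply: sqintD => //; exact: sqintN. Qed.
Lemma sqintJ f : sqint f -> sqint (fun x => (f x)^*).
Proof.
by move=> [mf jf]; split; [exact: cmeasurableJ|under eq_fun do rewrite sqJ].
Qed.
Lemma sqint0 : sqint (fun=> 0).
Proof.
split; first exact: cmeasurable_cst.
by under eq_fun do rewrite sq0; exact: integrable0.
Qed.
Lemma sqint_sum (I : Type) (s : seq I) (F : I -> R -> R[i]) :
  (forall i, sqint (F i)) -> sqint (fun x => \sum_(i <- s) F i x).
Proof.
move=> mF; elim: s => [|i s IH].
  by under eq_fun do rewrite big_nil; exact: sqint0.
by under eq_fun do rewrite big_cons; exact: sqintD.
Qed.
Lemma sqint_unimodular (u : R -> R[i]) f : cmeasurable u ->
  (forall x, sq (u x) <= 1) -> sqint f -> sqint (fun x => u x * f x).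
Proof.
move=> mu1 u1 sf; apply: (sqint_dom _ sf).
  by apply: cmeasurableM => //; case: sf.
by move=> x; rewrite sqM ler_piMl// sq_ge0.
Qed.
Lemma sqint_cut (A : set R) f : measurable A -> sqint f ->
  sqint (fun x => (\1_A x)%:C * f x).
Proof.
move=> mA; apply: sqint_unimodular; first exact: cmeasurable_indic.
by move=> x; rewrite sqC indicE; case: (_ \in _); rewrite ?expr1n ?expr0n.
Qed.

Lemma cintegrable_mulJ f g : sqint f -> sqint g ->
  cintegrable (fun x => f x * (g x)^*).
Proof.
move=> [mf jf] [mg jg].
apply: (@cintegrable_dominated _ _ (fun x => sq (f x) + sq (g x))).
- by apply: cmeasurableM => //; exact: cmeasurableJ.
- by rewrite (_ : _ \o _ = fun x => ((sq (f x))%:E + (sq (g x))%:E)%E)//; apply: integrableD => //.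
- by move=> x; rewrite addr_ge0 ?sq_ge0.
- move=> x; rewrite sqM sqJ.
  have := sq_ge0 (f x); have := sq_ge0 (g x); nra.
Qed.

Lemma inner_nrm2 f : inner f f = (nrm2 f)%:C.
Proof.
rewrite /inner; under eq_fun do rewrite mulcJ.
by apply: complex_ext => //=; rewrite /Rintegral integral0.
Qed.
Lemma innerJ f g : sqint f -> sqint g -> inner g f = (inner f g)^*.
Proof.
move=> sf sg; rewrite /inner -cintegralJ; last exact: cintegrable_mulJ.
by congr cintegral; apply/funext => x; rewrite conjcM conjc_conjc mulrC.
Qed.
Lemma innerDl f g h : sqint f -> sqint g -> sqint h ->
  inner (fun x => f x + g x) h = inner f h + inner g h.
Proof.
move=> sf sg sh; rewrite /inner; under eq_fun do rewrite mulrDl.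
by rewrite cintegralD//; exact: cintegrable_mulJ.
Qed.
Lemma innerZl c f g : sqint f -> sqint g ->
  inner (fun x => c * f x) g = c * inner f g.
Proof.
move=> sf sg; rewrite /inner; under eq_fun do rewrite -mulrA.
by rewrite cintegralZ//; exact: cintegrable_mulJ.
Qed.
Lemma innerDr f g h : sqint f -> sqint g -> sqint h ->
  inner h (fun x => f x + g x) = inner h f + inner h g.
Proof.
move=> sf sg sh.
by rewrite innerJ ?innerDl ?conjcD -?innerJ//; exact: sqintD.
Qed.
Lemma innerZr c f g : sqint f -> sqint g ->
  inner g (fun x => c * f x) = c^* * inner g f.
Proof.
move=> sf sg.
by rewrite innerJ ?innerZl ?conjcM -?innerJ//; exact: sqintZ.
Qed.
Lemma innerNl f g : sqint f -> sqint g -> inner (fun x => - f x) g = - inner f g.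
Proof.
move=> sf sg; rewrite -mulN1r -innerZl//.
by under [in RHS]eq_fun do rewrite mulN1r.
Qed.
Lemma innerBl f g h : sqint f -> sqint g -> sqint h ->
  inner (fun x => f x - g x) h = inner f h - inner g h.
Proof. by move=> sf sg sh; rewrite innerDl ?innerNl//; exact: sqintN. Qed.
Lemma inner_suml (I : Type) (s : seq I) (F : I -> R -> R[i]) g :
  (forall i, sqint (F i)) -> sqint g ->
  inner (fun x => \sum_(i <- s) F i x) g = \sum_(i <- s) inner (F i) g.
Proof.
move=> sF sg; rewrite /inner; under eq_fun do rewrite mulr_suml.
by have [] := @cintegral_sum _ _ s (fun i x => F i x * (g x)^*) (fun i => cintegrable_mulJ (sF i) sg).
Qed.

Lemma nrm2D f g : sqint f -> sqint g ->
  nrm2 (fun x => f x + g x) = nrm2 f + nrm2 g + 2 * Re (inner f g).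
Proof.
move=> sf sg.
have := inner_nrm2 (fun x => f x + g x).
rewrite innerDl ?innerDr//; try exact: sqintD.
rewrite !inner_nrm2// (innerJ sf sg) => /(congr1 (fun z : R[i] => Re z)).
by rewrite !ReImE /= => <-; ring.
Qed.
Lemma nrm2Z c f : sqint f -> nrm2 (fun x => c * f x) = sq c * nrm2 f.
Proof.
move=> [mf jf]; rewrite /nrm2; under eq_Rintegral do rewrite sqM.
by rewrite RintegralZl.
Qed.
Lemma nrm2N f : nrm2 (fun x => - f x) = nrm2 f.
Proof. by rewrite /nrm2; under eq_Rintegral do rewrite sqN. Qed.
Lemma nrm2_swap f g : nrm2 (fun x => f x - g x) = nrm2 (fun x => g x - f x).
Proof. by rewrite -nrm2N; congr nrm2; apply/funext => x; rewrite opprB. Qed.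
Lemma nrm2B f g : sqint f -> sqint g ->
  nrm2 (fun x => f x - g x) = nrm2 f + nrm2 g - 2 * Re (inner f g).
Proof.
move=> sf sg; rewrite nrm2D//; last exact: sqintN.
rewrite nrm2N (innerJ (sqintN sg) sf) innerNl// (innerJ sf sg).
by rewrite !ReImE; ring.
Qed.
Lemma nrm2D_le f g : sqint f -> sqint g ->
  nrm2 (fun x => f x + g x) <= 2 * nrm2 f + 2 * nrm2 g.
Proof.
move=> sf sg; rewrite nrm2D// -subr_ge0.
have := nrm2_ge0 (fun x => f x - g x); rewrite nrm2B//; lra.
Qed.
(** Since [nrm2] is a square, the triangle inequality costs a factor 2. *)
Lemma nrm2_triangle f g h : sqint f -> sqint g -> sqint h ->
  nrm2 (fun x => f x - h x) <=
  2 * nrm2 (fun x => f x - g x) + 2 * nrm2 (fun x => g x - h x).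
Proof.
move=> sf sg sh.
have -> : (fun x => f x - h x) = (fun x => (f x - g x) + (g x - h x)).
  by apply/funext => x; rewrite addrA subrK.
by apply: nrm2D_le; exact: sqintB.
Qed.
End square_integrable.

(** * Passing to the limit in L2 *)

Section limits.
Variable R : realType.
Notation mu := (@lebesgue_measure R).
Implicit Types (f g : R -> R[i]) (u v : nat -> R[i]).

Definition cvgc u (l : R[i]) :=
  (fun n => Re (u n)) @ \oo --> Re l /\ (fun n => Im (u n)) @ \oo --> Im l.

Lemma cvgc_cst (l : R[i]) : cvgc (fun=> l) l.
Proof. by split; exact: cvg_cst. Qed.
Lemma cvgcD u v (l m : R[i]) : cvgc u l -> cvgc v m ->
  cvgc (fun n => u n + v n) (l + m).
Proof.
move=> [ru ju] [rv jv]; split.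
  by under eq_fun do rewrite RecD; rewrite RecD; exact: cvgD.
by under eq_fun do rewrite ImcD; rewrite ImcD; exact: cvgD.
Qed.
Lemma cvgcM u v (l m : R[i]) : cvgc u l -> cvgc v m ->
  cvgc (fun n => u n * v n) (l * m).
Proof.
move=> [ru ju] [rv jv]; split.
  by under eq_fun do rewrite RecM; rewrite RecM; apply: cvgB; exact: cvgM.
by under eq_fun do rewrite ImcM; rewrite ImcM; apply: cvgD; exact: cvgM.
Qed.
Lemma cvgcB u v (l m : R[i]) : cvgc u l -> cvgc v m ->
  cvgc (fun n => u n - v n) (l - m).
Proof.
move=> cu cv; have := cvgcD cu (cvgcM (cvgc_cst (-1)) cv).
by under eq_fun do rewrite mulN1r; rewrite mulN1r.
Qed.
Lemma cvgc_sq u (l : R[i]) : cvgc u l -> (fun n => sq (u n)) @ \oo --> sq l.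
Proof. by move=> [ru ju]; apply: cvgD; apply: cvgM. Qed.
Lemma cvgc_near u (l : R[i]) N : (forall n, (N <= n)%N -> u n = l) -> cvgc u l.
Proof.
by move=> ul; split; apply: cvg_near_cst; exists N => // n Nn /=; rewrite ul.
Qed.
Lemma cvgc0 u : (fun n => sq (u n)) @ \oo --> (0 : R) -> cvgc u 0.
Proof.
move=> u0.
have sqrtu : (fun n => Num.sqrt (sq (u n))) @ \oo --> (0 : R).
  rewrite -(@sqrtr0 R).
  by apply: (continuous_cvg _ (@sqrt_continuous R 0) u0).
have le_sqrt (a b : R) : `|a| ^+ 2 <= b -> `|a| <= Num.sqrt b.
  by move=> ab; rewrite -(ger0_norm (normr_ge0 a)) -sqrtr_sqr ler_wsqrtr.
have Nsqrtu : (fun n => - Num.sqrt (sq (u n))) @ \oo --> (0 : R).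
  by rewrite -[X in _ --> X]oppr0; exact: cvgN.
split; apply: (squeeze_cvgr _ Nsqrtu sqrtu); near=> n; rewrite -ler_norml le_sqrt//;
  [exact: absRe_le|exact: absIm_le].
Unshelve. all: by end_near. Qed.

Lemma cvg0_eps (a : nat -> R) e : a @ \oo --> (0 : R) -> 0 < e ->
  exists N, forall n, (N <= n)%N -> a n < e.
Proof.
by move=> a0 e0; have [N _ H] := cvgr_lt 0 a0 e e0; exists N => n /H.
Qed.
Lemma eps_cvg0 (a : nat -> R) : (forall n, 0 <= a n) ->
  (forall e, 0 < e -> exists N, forall n, (N <= n)%N -> a n <= e) ->
  a @ \oo --> (0 : R).
Proof.
move=> a0 H; apply/cvgr0Pnorm_le => e e0; have [N HN] := H e e0.
by exists N => // n Nn /=; rewrite ger0_norm// HN.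
Qed.

Lemma ae_imply (P Q : R -> Prop) : {ae mu, forall x, P x} ->
  (forall x, P x -> Q x) -> {ae mu, forall x, Q x}.
Proof.
move=> [N [mN N0 PN]] PQ; exists N; split => //.
by apply: subset_trans PN; apply: subsetC => x; exact: PQ.
Qed.

Lemma ae_imply2 (P Q S : R -> Prop) : {ae mu, forall x, P x} ->
  {ae mu, forall x, Q x} -> (forall x, P x -> Q x -> S x) -> {ae mu, forall x, S x}.
Proof.
move=> [N [mN N0 PN]] [M [mM M0 QM]] PQS; exists (N `|` M); split.
- exact: measurableU.
- by rewrite measureU0.
- move=> x /= Sx; have [Px|/PN] := pselect (P x); last by left.
  by right; apply: QM => Qx; apply: Sx; exact: PQS.
Qed.

Lemma ae_neq (a : R) : {ae mu, forall t, t != a}.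
Proof.
exists [set a]; split; [exact: measurable_set1|exact: lebesgue_measure_set1|].
by move=> t /= /negP; rewrite negbK => /eqP.
Qed.

(** The means by which a.e. convergence gives membership in L2 when there is no
    dominating function, as for partial Fourier sums. *)
Lemma nrm2_fatou (F_ : nat -> R -> R[i]) F (e : R) :
  (forall n, sqint (F_ n)) -> cmeasurable F ->
  {ae mu, forall x, cvgc (F_^~ x) (F x)} ->
  (forall n, nrm2 (F_ n) <= e) -> sqint F /\ nrm2 F <= e.
Proof.
move=> sF mF FF le_e.
have mE n : measurable_fun setT (fun x => (sq (F_ n x))%:E).
  by apply/measurable_EFinP; apply: measurable_sq; case: (sF n).
have msqF : measurable_fun setT (fun x => (sq (F x))%:E).
  by apply/measurable_EFinP; exact: measurable_sq.
have int_le : (\int[mu]_x (sq (F x))%:E <= e%:E)%E.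
  apply: (@le_trans _ _ (\int[mu]_x limn_einf (fun n => (sq (F_ n x))%:E))%E).
    apply: ae_ge0_le_integral => //.
    - by move=> x _; rewrite lee_fin sq_ge0.
    - move=> x _; rewrite limn_einf_lim; apply: lime_ge.
        exact: is_cvg_einfs.
      apply: nearW => n; apply: le_ereal_inf_tmp => _ [m _ <-].
      by rewrite lee_fin sq_ge0.
    - apply: measurableT_comp => //; apply: measurable_fun_limn_esup => n.
      rewrite (_ : (fun x => _) = EFin \o (fun x => - sq (F_ n x)))//.
      apply/measurable_EFinP; apply: measurableT_comp => //.
      by apply: measurable_sq; case: (sF n).
    - apply: (ae_imply FF) => x /cvgc_sq cx _.
      have : (fun n => (sq (F_ n x))%:E) @ \oo --> (sq (F x))%:E.
        exact: cvg_comp cx _.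
      by move/cvg_limn_einf_sup => [-> _].
  apply: le_trans (fatou _ _ _ _) _ => //.
    by move=> n x _; rewrite lee_fin sq_ge0.
  rewrite limn_einf_lim; apply: lime_le; first exact: is_cvg_einfs.
  apply: nearW => n; apply: (@le_trans _ _ (\int[mu]_x (sq (F_ n x))%:E)%E).
    by apply: ereal_inf_lbound; exists n => /=.
  by rewrite nrm2_EFin// lee_fin.
have sqF : sqint F.
  split => //; apply/integrableP; split => //.
  under eq_integral do rewrite gee0_abs ?lee_fin ?sq_ge0//.
  exact: (le_lt_trans int_le (ltry _)).
by split => //; rewrite -lee_fin -nrm2_EFin.
Qed.

(** Used with [G] equal to the term of index [N]: if a sequence converges a.e. and
    its terms of index at least [N] stay close to that term in L2, then so does
    its limit. Hence the L2 limit of a Cauchy sequence is its a.e. limit. *)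
Lemma nrm2_fatouB (F_ : nat -> R -> R[i]) F G (e : R) N :
  (forall n, sqint (F_ n)) -> sqint G -> cmeasurable F ->
  {ae mu, forall x, cvgc (F_^~ x) (F x)} ->
  (forall n, (N <= n)%N -> nrm2 (fun x => F_ n x - G x) <= e) ->
  sqint F /\ nrm2 (fun x => F x - G x) <= e.
Proof.
move=> sF sG mF FF le_e.
have [] := @nrm2_fatou (fun n x => F_ (n + N)%N x - G x) (fun x => F x - G x) e.
- by move=> n; exact: sqintB.
- by apply: cmeasurableB => //; case: sG.
- apply: (ae_imply FF) => x [rx jx]; apply: cvgcB; last exact: cvgc_cst.
  split.
    by rewrite (cvg_shiftn N (fun n => Re (F_ n x))).
  by rewrite (cvg_shiftn N (fun n => Im (F_ n x))).
- by move=> n; apply: le_e; exact: leq_addl.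
- move=> sFG ?; split => //; have := sqintD sFG sG.
  by under eq_fun do rewrite subrK.
Qed.

Lemma nrm2_dominated (F_ : nat -> R -> R[i]) F (h : R -> R) :
  (forall n, cmeasurable (F_ n)) -> cmeasurable F ->
  (forall x, cvgc (F_^~ x) (F x)) -> mu.-integrable setT (EFin \o h) ->
  (forall n x, sq (F_ n x - F x) <= h x) ->
  (fun n => nrm2 (fun x => F_ n x - F x)) @ \oo --> (0 : R).
Proof.
move=> mF_ mF FF ih leh.
rewrite (_ : (0 : R) = fine (\int[mu]_x (cst 0%E x))%E); last by rewrite integral0.
apply: fine_cvg; rewrite fineK; last by rewrite integral0.
apply: (@dominated_cvg _ _ _ mu _ _ (fun n x => (sq (F_ n x - F x))%:E) _ (EFin \o h)) => //.
- by move=> n; apply/measurable_EFinP; apply: measurable_sq; exact: cmeasurableB.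
- move=> x _; have := cvgc_sq (cvgcB (FF x) (cvgc_cst (F x))).
  by rewrite subrr sq0 => c0; exact: cvg_comp c0 _.
- by move=> n x _ /=; rewrite lee_fin ger0_norm ?sq_ge0.
Qed.

(** The Cauchy-Schwarz inequality with a free weight [d] in place of square roots:
    expand the squared norms of [d f + g] and [d f - g]. *)
Lemma Re_inner_le f g (d : R) : sqint f -> sqint g -> 0 < d ->
  `|2 * Re (inner f g)| <= d * nrm2 f + d^-1 * nrm2 g.
Proof.
move=> sf sg d0.
have H (s : R) : s ^+ 2 = d ^+ 2 ->
    0 <= d ^+ 2 * nrm2 f + nrm2 g + 2 * (s * Re (inner f g)).
  move=> sd; have := nrm2_ge0 (fun x => s%:C * f x + g x).
  rewrite nrm2D//; last exact: sqintZ.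
  by rewrite nrm2Z// innerZl// sqC sd RecM /= mul0r subr0.
have Hp := H d erefl; have Hm := H (- d) (sqrrN d).
rewrite -(ler_pM2l d0) mulrDr mulrA -expr2 mulrA divff ?gt_eqF// mul1r.
rewrite -{1}(gtr0_norm d0) -normrM ler_norml; apply/andP; split; lra.
Qed.

Lemma nrm2_cvg (F_ : nat -> R -> R[i]) F : (forall n, sqint (F_ n)) -> sqint F ->
  (fun n => nrm2 (fun x => F_ n x - F x)) @ \oo --> (0 : R) ->
  (fun n => nrm2 (F_ n)) @ \oo --> nrm2 F.
Proof.
move=> sF_ sF cF; apply/subr_cvg0/cvgr0Pnorm_le => e e0.
pose d := e / (2 * (nrm2 F + 1)).
have nF1 : 0 < nrm2 F + 1 by rewrite ltr_wpDl ?nrm2_ge0.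
have d0 : 0 < d by rewrite divr_gt0// mulr_gt0.
have d1 : 0 < 1 + d^-1 by rewrite addr_gt0// invr_gt0.
have [N HN] : exists N, forall n, (N <= n)%N ->
    nrm2 (fun x => F_ n x - F x) < e / (2 * (1 + d^-1)).
  by apply: (cvg0_eps cF); rewrite divr_gt0// mulr_gt0.
exists N => // n /= /HN; rewrite ltr_pdivlMr ?mulr_gt0// => lt_e.
have sD := sqintB (sF_ n) sF.
have -> : F_ n = (fun x => F x + (F_ n x - F x)).
  by apply/funext => x; rewrite addrC subrK.
rewrite nrm2D//.
have dF : d * nrm2 F <= e / 2.
  rewrite /d invfM mulrA -mulrA ler_piMr ?divr_ge0 ?ltW//.
  by rewrite ltr_pdivrMl// mulr1 ltrDl.
have := Re_inner_le sF sD d0; move: lt_e.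
move: (nrm2_ge0 (fun x => F_ n x - F x)).
rewrite !ler_norml => q0 lt_e /andP[lo hi]; apply/andP; split; nra.
Qed.

Lemma nrm2_cut_cvg (A : nat -> set R) f : sqint f -> (forall n, measurable (A n)) ->
  (forall x, exists N, forall n, (N <= n)%N -> (\1_(A n) x)%:C * f x = f x) ->
  (fun n => nrm2 (fun x => (\1_(A n) x)%:C * f x - f x)) @ \oo --> (0 : R).
Proof.
move=> sf mA Af.
apply: (@nrm2_dominated _ _ (fun x => sq (f x))).
- by move=> n; have [] := sqint_cut (mA n) sf.
- by case: sf.
- by move=> x; have [N HN] := Af x; exact: (@cvgc_near _ _ N).
- by case: sf.
- move=> n x; rewrite indicE; case: (_ \in _); rewrite ?mul1r ?subrr ?sq0 ?sq_ge0//.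
  by rewrite mul0r sub0r sqN.
Qed.
End limits.

(** * Orthogonal families and closed spans *)

Section orthogonal_families.
Variables (R : realType) (I : eqType) (e : I -> R -> R[i]) (T : R).
Hypothesis T0 : 0 < T.
Hypothesis se : forall i, sqint (e i).
Hypothesis orth : forall i j, inner (e i) (e j) = (if i == j then T else 0)%:C.
Implicit Types (s : seq I) (c d : I -> R[i]) (f : R -> R[i]).

Definition comb s c (x : R) : R[i] := \sum_(i <- s) c i * e i x.
(** The normalisation reflects that each [e i] has squared norm [T]. *)
Definition coef f i : R[i] := inner f (e i) / T%:C.

Lemma sqint_comb s c : sqint (comb s c).
Proof. by apply: sqint_sum => i; exact: sqintZ. Qed.

Lemma inner_comb_e s c j : uniq s ->
  inner (comb s c) (e j) = if j \in s then T%:C * c j else 0.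
Proof.
move=> us; rewrite /comb inner_suml//; last by move=> i; exact: sqintZ.
under eq_bigr do rewrite innerZl// orth.
have [js|js] := ifPn.
  rewrite (bigD1_seq j)//= eqxx mulrC big1_seq ?addr0// => i /andP[/negbTE ij _].
  by rewrite ij mulr0.
rewrite big1_seq// => i /andP[_ si]; case: eqP => [ij|_]; last by rewrite mulr0.
by move: js; rewrite -ij si.
Qed.

Lemma inner_f_comb s d f : sqint f ->
  inner f (comb s d) = \sum_(i <- s) (d i)^* * (T%:C * coef f i).
Proof.
move=> sf; rewrite (innerJ (sqint_comb s d) sf) /comb inner_suml//; last first.
  by move=> i; exact: sqintZ.
rewrite conjc_sum; apply: eq_bigr => i _.
rewrite innerZl// conjcM -innerJ// /coef; congr (_ * _).
have T0' : T%:C != 0 by rewrite eq_complex /= gt_eqF.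
by field.
Qed.

Lemma nrm2_comb s c : uniq s ->
  nrm2 (comb s c) = T * \sum_(i <- s) sq (c i).
Proof.
move=> us; have := inner_nrm2 (comb s c).
rewrite inner_f_comb; last exact: sqint_comb.
have cE i : i \in s -> (c i)^* * (T%:C * coef (comb s c) i) = (T * sq (c i))%:C.
  move=> si; rewrite /coef inner_comb_e// si RC_M -mulcJ.
  have T0' : T%:C != 0 by rewrite eq_complex /= gt_eqF.
  by field.
rewrite big_seq; under eq_bigr => i si do rewrite cE//.
by rewrite -big_seq -RC_sum => -[<-]; rewrite mulr_sumr.
Qed.

(** Completing the square in the coefficients; Bessel's inequality, the distance
    to the span and the best approximation property are read off from this. *)
Lemma nrm2_sub_comb s d f : uniq s -> sqint f ->
  nrm2 (fun x => f x - comb s d x) =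
  nrm2 f - T * \sum_(i <- s) sq (coef f i)
         + T * \sum_(i <- s) sq (d i - coef f i).
Proof.
move=> us sf; rewrite nrm2B//; last exact: sqint_comb.
rewrite nrm2_comb// inner_f_comb// Re_sum !mulr_sumr.
rewrite -!addrA; congr (_ + _).
rewrite -!sumrN -!big_split /=.
apply: eq_bigr => i _; rewrite /sq !ReImE /=; ring.
Qed.

Lemma bessel s f : uniq s -> sqint f ->
  T * \sum_(i <- s) sq (coef f i) <= nrm2 f.
Proof.
move=> us sf; rewrite -subr_ge0.
have := nrm2_sub_comb (coef f) us sf.
under [X in _ + T * X]eq_bigr do rewrite subrr sq0.
by rewrite big1_eq mulr0 addr0 => <-; exact: nrm2_ge0.
Qed.

Lemma nrm2_sub_proj s f : uniq s -> sqint f ->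
  nrm2 (fun x => f x - comb s (coef f) x) =
  nrm2 f - T * \sum_(i <- s) sq (coef f i).
Proof.
move=> us sf; rewrite nrm2_sub_comb//.
under [X in _ + T * X]eq_bigr do rewrite subrr sq0.
by rewrite big1_eq mulr0 addr0.
Qed.

Lemma best_approximation s d f : uniq s -> sqint f ->
  nrm2 (fun x => f x - comb s (coef f) x) <= nrm2 (fun x => f x - comb s d x).
Proof.
move=> us sf; rewrite nrm2_sub_proj// nrm2_sub_comb// lerDl mulr_ge0//.
  exact: ltW.
by apply: sumr_ge0 => i _; exact: sq_ge0.
Qed.

(** Pythagoras. With Bessel's inequality it makes the partial sums of an
    orthogonal expansion a Cauchy sequence. *)
Lemma nrm2_comb_tail s t c : uniq s -> uniq t -> {subset s <= t} ->
  nrm2 (fun x => comb t c x - comb s c x) =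
  T * \sum_(i <- t) sq (c i) - T * \sum_(i <- s) sq (c i).
Proof.
move=> us ut st.
have pst : perm_eq [seq i <- t | i \in s] s.
  apply: uniq_perm => //; first exact: filter_uniq.
  by move=> i; rewrite mem_filter; case: (boolP (i \in s)) => //= /st.
have sumE (V : nmodType) (F : I -> V) : \sum_(i <- t) F i =
    \sum_(i <- s) F i + \sum_(i <- [seq i <- t | i \notin s]) F i.
  rewrite (bigID (fun i => i \in s)) /= -big_filter; congr (_ + _).
    exact: perm_big.
  by rewrite big_filter.
rewrite !(sumE _ (fun i => sq (c i))) mulrDr addrC addKr -nrm2_comb ?filter_uniq//.
by congr nrm2; apply/funext => x; rewrite /comb (sumE _ (fun i => c i * e i x)) addrC addKr.
Qed.
End orthogonal_families.

Section closed_span.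
Variable R : realType.
Implicit Types (f g : R -> R[i]).

(** Indices may repeat, so that sums and multiples of combinations are obtained by
    concatenating and scaling lists; [lcomb_comb] collects equal indices. *)
Definition lcomb (I : Type) (e : I -> R -> R[i]) (l : seq (R[i] * I)) (x : R) : R[i] :=
  \sum_(p <- l) p.1 * e p.2 x.

(** Membership in the closed linear span of the family [e] in L2. *)
Definition in_span (I : Type) (e : I -> R -> R[i]) f :=
  sqint f /\ forall eps, 0 < eps ->
    exists l, nrm2 (fun x => f x - lcomb e l x) < eps.

Lemma lcomb_comb (I : eqType) (e : I -> R -> R[i]) l s : uniq s ->
  (forall p, p \in l -> p.2 \in s) ->
  lcomb e l = comb e s (fun i => \sum_(p <- l | p.2 == i) p.1).
Proof.
move=> us ls; apply/funext => x; rewrite /lcomb /comb.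
under [RHS]eq_bigr do rewrite mulr_suml.
rewrite (exchange_big_dep predT)//= big_seq [RHS]big_seq.
apply: eq_bigr => p pl; rewrite [RHS]big_mkcond (bigD1_seq p.2) ?ls//= eqxx.
by rewrite big1 ?addr0// => i /negbTE; rewrite eq_sym => ->.
Qed.

Section fixed_family.
Variables (I : Type) (e : I -> R -> R[i]).
Hypothesis se : forall i, sqint (e i).

Lemma sqint_lcomb l : sqint (lcomb e l).
Proof. by apply: sqint_sum => i; exact: sqintZ. Qed.

Lemma in_span_lcomb l : in_span e (lcomb e l).
Proof.
split; first exact: sqint_lcomb.
move=> eps eps0; exists l; rewrite /nrm2; under eq_Rintegral do rewrite subrr sq0.
by rewrite /Rintegral integral0.
Qed.

Lemma in_span_lim f : sqint f ->
  (forall eps, 0 < eps -> exists2 g, in_span e g & nrm2 (fun x => f x - g x) <= eps) ->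
  in_span e f.
Proof.
move=> sf H; split => // eps eps0.
have eps4 : 0 < eps / 8 by rewrite divr_gt0.
have [g [sg Hg] fg] := H _ eps4.
have [l gl] := Hg _ eps4.
exists l; apply: le_lt_trans (nrm2_triangle sf sg (sqint_lcomb l)) _.
lra.
Qed.

Lemma in_spanD f g : in_span e f -> in_span e g -> in_span e (fun x => f x + g x).
Proof.
move=> [sf Hf] [sg Hg]; split; first exact: sqintD.
move=> eps eps0; have eps4 : 0 < eps / 4 by rewrite divr_gt0.
have [l fl] := Hf _ eps4; have [k gk] := Hg _ eps4.
exists (l ++ k).
have -> : (fun x => f x + g x - lcomb e (l ++ k) x) =
    (fun x => (f x - lcomb e l x) + (g x - lcomb e k x)).
  by apply/funext => x; rewrite /lcomb big_cat /=; ring.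
apply: le_lt_trans (nrm2D_le _ _) _; try by apply: sqintB => //; exact: sqint_lcomb.
lra.
Qed.

Lemma in_spanZ c f : in_span e f -> in_span e (fun x => c * f x).
Proof.
move=> [sf Hf]; split; first exact: sqintZ.
move=> eps eps0; have c1 : 0 < sq c + 1 by rewrite ltr_wpDl ?sq_ge0.
have [l fl] := Hf _ (divr_gt0 eps0 c1).
exists [seq (c * p.1, p.2) | p <- l].
have -> : (fun x => c * f x - lcomb e [seq (c * p.1, p.2) | p <- l] x) =
    (fun x => c * (f x - lcomb e l x)).
  apply/funext => x; rewrite mulrBr; congr (_ - _).
  by rewrite /lcomb big_map mulr_sumr; apply: eq_bigr => p _; rewrite mulrA.
rewrite nrm2Z; last by apply: sqintB => //; exact: sqint_lcomb.
move: fl; rewrite ltr_pdivlMr// => fl.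
apply: le_lt_trans fl; rewrite mulrC ler_wpM2l ?nrm2_ge0// lerDl//.
Qed.

Lemma in_span0 : in_span e (fun=> 0).
Proof.
have := in_span_lcomb [::]; congr in_span.
by apply/funext => x; rewrite /lcomb big_nil.
Qed.

Lemma in_spanB f g : in_span e f -> in_span e g -> in_span e (fun x => f x - g x).
Proof.
move=> ef eg; have := in_spanD ef (in_spanZ (-1) eg).
by under eq_fun do rewrite mulN1r.
Qed.

Lemma in_span_gen i : in_span e (e i).
Proof.
have := in_span_lcomb [:: (1, i)]; congr in_span.
by apply/funext => x; rewrite /lcomb big_seq1 mul1r.
Qed.

Lemma in_span_sum (J : Type) (s : seq J) (F : J -> R -> R[i]) :
  (forall j, in_span e (F j)) -> in_span e (fun x => \sum_(j <- s) F j x).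
Proof.
move=> eF; elim: s => [|j s IH].
  by under eq_fun do rewrite big_nil; exact: in_span0.
by under eq_fun do rewrite big_cons; exact: in_spanD.
Qed.
End fixed_family.

End closed_span.

Import HBSimple HBNNSimple.

(** * Reduction to jump functions *)

Section span_of_indicators.
Variables (R : realType) (I : Type) (e : I -> R -> R[i]) (E : set R).
Notation mu := (@lebesgue_measure R).
Hypothesis se : forall i, sqint (e i).
Hypothesis mE : measurable E.
Hypothesis finE : (mu E < +oo)%E.

Definition ind (A : set R) (x : R) : R[i] := (\1_A x)%:C.

Lemma ind1 (A : set R) x : A x -> ind A x = 1.
Proof. by move=> Ax; rewrite /ind indicE mem_set. Qed.
Lemma ind0 (A : set R) x : ~ A x -> ind A x = 0.
Proof. by move=> Ax; rewrite /ind indicE memNset. Qed.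
Lemma ind_setI (A B : set R) x : ind (A `&` B) x = ind A x * ind B x.
Proof. by rewrite /ind indicI RC_M. Qed.

Lemma ind_conj (A : set R) x : (ind A x)^* = ind A x.
Proof. exact: conjcR. Qed.

Lemma integrable_indic_fin (A : set R) : measurable A -> (mu A < +oo)%E ->
  mu.-integrable setT (fun x => (\1_A x)%:E).
Proof.
move=> mA fA; apply/integrableP; split.
  by apply/measurable_EFinP; exact: measurable_indic.
under eq_integral do rewrite gee0_abs ?lee_fin//.
by rewrite integral_indic// setIT.
Qed.

Lemma sqint_ind (A : set R) : measurable A -> (mu A < +oo)%E -> sqint (ind A).
Proof.
move=> mA fA; apply: (sqint_le _ (integrable_indic_fin mA fA)).
  exact: cmeasurable_indic.
by move=> x; rewrite sqC indicE; case: (_ \in _); rewrite ?expr1n ?expr0n.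
Qed.

Lemma sqint_indI (A : set R) : measurable A -> sqint (ind (A `&` E)).
Proof.
move=> mA; apply: sqint_ind; first exact: measurableI.
apply: le_lt_trans finE; apply: le_measure; rewrite ?inE//; exact: measurableI.
Qed.

Hypothesis spanE : in_span e (ind E).
Hypothesis span_ray : forall a, in_span e (ind (`]-oo, a[ `&` E)).

(** The sets [A] for which the indicator of [A `&` E] lies in the closed span form
    a Dynkin class: complements are differences, and disjoint unions are L2 limits.
    The rays form a pi-system that generates the Borel sets. *)
Lemma in_span_ind (A : set R) : measurable A -> in_span e (ind (A `&` E)).
Proof.
have mRE := RGenInftyO.measurableE R.
move=> mA; have : <<s @RGenInftyO.G R >> A 
  by change ((@RGenInftyO.G R).-sigma.-measurable A); rewrite -mRE.
move: A {mA}; apply: (dynkin_induction mRE).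
- move=> _ _ [a ->] [b ->].
  exists (Order.min a b); apply/seteqP; split => x /=; rewrite !in_itv /= lt_min.
    by move=> [-> ->].
  by move=> /andP[].
- by rewrite setTI.
- by move=> _ [a ->]; exact: span_ray.
- move=> S mS eS.
  rewrite (_ : ind _ = fun x => ind E x - ind (S `&` E) x); first exact: in_spanB.
  apply/funext => x; rewrite !ind_setI; have [Sx|Sx] := pselect (S x).
    by rewrite (ind1 Sx) ind0 ?mul0r ?mul1r ?subrr// => /(_ Sx).
  by rewrite (ind0 Sx) ind1// mul0r mul1r subr0.
- move=> F mF tF eF.
  have mU n : measurable (\big[setU/set0]_(k < n) F k) by exact: bigsetU_measurable.
  have eU n : in_span e (ind (\big[setU/set0]_(k < n) F k `&` E)).
    elim: n => [|n IH].
      rewrite big_ord0 set0I (_ : ind set0 = fun=> 0); first exact: in_span0.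
      by apply/funext => x; rewrite ind0.
    rewrite (_ : ind _ = fun x => ind (\big[setU/set0]_(k < n) F k `&` E) x +
      ind (F n `&` E) x); first exact: in_spanD.
    apply/funext => x; rewrite !ind_setI -mulrDl; congr (_ * _).
    rewrite big_ord_recr /=; have [Fx|Fx] := pselect (F n x).
      rewrite (ind1 Fx) ind1; last by right.
      rewrite ind0 ?add0r// ; last rewrite -bigcup_mkord => -[k /= kn Fkx].
      have : n = k by apply: tF => //; exists x.
      by move=> nk; rewrite nk ltnn in kn.
    rewrite (ind0 Fx) addr0.
    have [Ux|Ux] := pselect ((\big[setU/set0]_(k < n) F k) x).
      by rewrite !ind1//; left.
    by rewrite !ind0// => -[].
  have sf : sqint (ind (\bigcup_k F k `&` E)).
    by apply: sqint_indI; exact: bigcupT_measurable.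
  apply: in_span_lim => // eps eps0.
  have cU : (fun n => nrm2 (fun x => ind (\big[setU/set0]_(k < n) F k) x *
      ind (\bigcup_k F k `&` E) x - ind (\bigcup_k F k `&` E) x)) @ \oo --> (0 : R).
    apply: nrm2_cut_cvg => // x; have [[k _ Fkx]|Ux] := pselect ((\bigcup_k F k) x).
      exists k.+1 => n kn; rewrite (_ : (_)%:C = 1) ?mul1r//.
      by apply: ind1; rewrite -bigcup_mkord; exists k.
    by exists 0%N => n _; rewrite (@ind0 (_ `&` _)) ?mulr0// => -[].
  have [N HN] := cvg0_eps cU eps0.
  exists (ind (\big[setU/set0]_(k < N) F k `&` E)) => //.
  rewrite nrm2_swap; apply: ltW; apply: le_lt_trans (HN N (leqnn _)).
  rewrite le_eqVlt; apply/orP; left; apply/eqP; congr nrm2; apply/funext => x.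
  rewrite !ind_setI mulrA; congr (_ * _ - _).
  have [Ux|Ux] := pselect ((\big[setU/set0]_(k < N) F k) x).
    rewrite (ind1 Ux) ind1 ?mulr1//.
    by move: Ux; rewrite -bigcup_mkord => -[k _ Fk]; exists k.
  by rewrite (ind0 Ux) mul0r.
Qed.

(** Increasing simple approximations converge in L2, being dominated by [r]. *)
Lemma in_span_ge0 (r : R -> R) : measurable_fun setT r -> (forall x, 0 <= r x) ->
  sqint (fun x => (r x)%:C) -> (forall x, ~ E x -> r x = 0) ->
  in_span e (fun x => (r x)%:C).
Proof.
move=> mr r0 sr rE.
have mrE : measurable_fun setT (EFin \o r) by exact/measurable_EFinP.
have r0E x : setT x -> (0 <= (EFin \o r) x)%E by move=> _; rewrite lee_fin.
pose s n := nnsfun_approx measurableT mrE n.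
have s_le n x : 0 <= s n x <= r x.
  rewrite fun_ge0/= /s nnsfun_approxE -lee_fin.
  by apply: (le_approx n (f := EFin \o r)).
have s_cvg x : (fun n => s n x) @ \oo --> r x.
  have := cvg_nnsfun_approx measurableT mrE r0E (x := x) Logic.I.
  by move=> /fine_cvg.
have es n : in_span e (fun x => (s n x)%:C * ind E x).
  rewrite (_ : (fun _ => _) = (fun x => \sum_(y <- finmap.enum_fset (fset_set (range (s n))))
      y%:C * ind (s n @^-1` [set y] `&` E) x)).
    apply: in_span_sum => // y; apply: in_spanZ => //; apply: in_span_ind.
    exact: measurable_sfunP.
  apply/funext => x; rewrite fimfunE fsbig_finite//= RC_sum mulr_suml.
  by apply: eq_bigr => y _; rewrite ind_setI RC_M mulrA.
have cs : (fun n => nrm2 (fun x => (s n x)%:C * ind E x - (r x)%:C)) @ \oo --> (0 : R).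
  apply: (@nrm2_dominated _ _ _ (fun x => sq (r x)%:C)).
  - by move=> n; have [[]] := es n.
  - by case: sr.
  - move=> x; split; last first.
      by under eq_fun do rewrite ImcM /= mulr0 mul0r addr0; exact: cvg_cst.
    under eq_fun do rewrite RecM /= mul0r subr0.
    have [Ex|Ex] := pselect (E x).
      by under eq_fun do rewrite indicE mem_set//= mulr1; exact: s_cvg.
    under eq_fun do rewrite indicE memNset//= mulr0.
    by rewrite rE//; exact: cvg_cst.
  - by case: sr.
  - move=> n x; have [Ex|Ex] := pselect (E x).
      rewrite (ind1 Ex) mulr1 -RC_N -RC_D !sqC.
      have /andP[] := s_le n x; nra.
    by rewrite (ind0 Ex) mulr0 rE// subr0.
apply: in_span_lim => // eps eps0; have [N HN] := cvg0_eps cs eps0.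
by exists (fun x => (s N x)%:C * ind E x) => //; rewrite nrm2_swap ltW// HN.
Qed.

Lemma in_span_real (r : R -> R) : measurable_fun setT r ->
  sqint (fun x => (r x)%:C) -> (forall x, ~ E x -> r x = 0) ->
  in_span e (fun x => (r x)%:C).
Proof.
move=> mr sr rE.
have mp : measurable_fun setT (fun x => Num.max (r x) 0) by exact: measurable_maxr.
have mn : measurable_fun setT (fun x => Num.max (- r x) 0).
  by apply: measurable_maxr => //; exact: measurableT_comp.
rewrite (_ : (fun x => _) = fun x => (Num.max (r x) 0)%:C - (Num.max (- r x) 0)%:C).
  apply: in_spanB => //; apply: in_span_ge0 => //.
  - by move=> x; rewrite le_max lexx orbT.
  - apply: (sqint_dom _ sr); first exact: cmeasurableC.
    by move=> x; rewrite !sqC; case: (leP (r x) 0) => // _; rewrite expr0n sqr_ge0.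
  - by move=> x /rE ->; rewrite maxxx.
  - by move=> x; rewrite le_max lexx orbT.
  - apply: (sqint_dom _ sr); first exact: cmeasurableC.
    move=> x; rewrite !sqC; case: (leP (- r x) 0) => // _; last by rewrite sqrrN.
    by rewrite expr0n sqr_ge0.
  - by move=> x /rE ->; rewrite oppr0 maxxx.
apply/funext => x; rewrite -RC_N -RC_D; congr (_%:C).
case: (leP (r x) 0) => rx; case: (leP (- r x) 0) => nrx; lra.
Qed.

(** A family is complete in L2(E) as soon as its closed span contains the
    indicators of [E] and of the traces on [E] of all rays. *)
Lemma in_span_supported (f : R -> R[i]) : sqint f ->
  (forall x, ~ E x -> f x = 0) -> in_span e f.
Proof.
move=> sf fE; have [[mr mi] _] := sf.
rewrite (_ : f = fun x => (Re (f x))%:C + 'i%C * (Im (f x))%:C); last first.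
  by apply/funext => x; rewrite -complexE.
apply: in_spanD => //; last apply: in_spanZ => //; apply: in_span_real => //.
- apply: (sqint_dom _ sf); first exact: cmeasurableC.
  by move=> x; rewrite sqC /sq lerDl sqr_ge0.
- by move=> x /fE ->.
- apply: (sqint_dom _ sf); first exact: cmeasurableC.
  by move=> x; rewrite sqC /sq lerDr sqr_ge0.
- by move=> x /fE ->.
Qed.
End span_of_indicators.

(** * Completeness of an exponential system *)

Section symmetric_indices.

(** The integers from [- n] to [n], over which partial Fourier sums are taken. *)
Definition idx (n : nat) : seq int :=
  [seq Posz j | j <- iota 0 n.+1] ++ [seq Negz j | j <- iota 0 n].

Lemma mem_idx n k :
  (k \in idx n) = match k with Posz j => (j <= n)%N | Negz j => (j < n)%N end.
Proof.
rewrite mem_cat; case: k => j.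
  rewrite mem_map; last by move=> a b [].
  rewrite mem_iota add0n ltnS /= (_ : Posz j \in _ = false) ?orbF//.
  by apply/negbTE/mapP => -[].
rewrite (_ : Negz j \in map Posz _ = false); last by apply/negbTE/mapP => -[].
by rewrite (mem_map (f := Negz)) ?mem_iota// => a b [].
Qed.

Lemma idx_uniq n : uniq (idx n).
Proof.
rewrite cat_uniq !map_inj_uniq ?iota_uniq ?andbT /=; try by move=> a b [].
by apply/hasPn => k /mapP[j _ ->]; apply/negP => /mapP[].
Qed.

Lemma idx_mono n m : (n <= m)%N -> {subset idx n <= idx m}.
Proof.
move=> nm k; rewrite !mem_idx; case: k => j jn; first exact: leq_trans jn nm.
exact: leq_trans jn nm.
Qed.

Lemma idx_cover (s : seq int) : exists N, forall n, (N <= n)%N -> {subset s <= idx n}.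
Proof.
exists (\max_(k <- s) absz k) => n Nn k ks.
have : (absz k <= n)%N by apply: leq_trans Nn; exact: (@leq_bigmax_seq _ s predT absz).
by rewrite mem_idx; case: k ks.
Qed.

(** [Negz n] is [- n - 1], the lower index left over by the shift. *)
Lemma idx_telescope (V : zmodType) (h : int -> V) n :
  \sum_(k <- idx n) (h (k - 1) - h k) = h (Negz n) - h (Posz n).
Proof.
rewrite big_cat !big_map /=.
have -> : \sum_(0 <= j < n.+1) (h (Posz j - 1) - h (Posz j)) = h (Negz 0) - h (Posz n).
  elim: n => [|n IH]; first by rewrite big_nat1.
  rewrite big_nat_recr//= IH (_ : Posz n.+1 - 1 = Posz n); first by rewrite addrA subrK.
  by rewrite -addn1 PoszD addrK.
rewrite -[iota 0 n](_ : index_iota 0 n = _); last by rewrite /index_iota subn0.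
have -> : \sum_(0 <= j < n) (h (Negz j - 1) - h (Negz j)) = h (Negz n) - h (Negz 0).
  rewrite -(@telescope_sumr _ 0 n (fun j => h (Negz j)))//.
  apply: eq_bigr => j _; congr (h _ - _).
  by rewrite !NegzE -[j.+2]addn1 PoszD opprD.
by rewrite addrC addrA subrK.
Qed.
End symmetric_indices.

(** For almost every [t] in [E], no point of [E] away from [t] is congruent to [t]
    modulo [T], in the quantitative form that makes 1 / (e^(2 pi i (x - t) / T) - 1)
    bounded for [x] in [E] away from [t]. *)
Definition exp_separated (R : realType) (E : set R) (T : R) :=
  {ae @lebesgue_measure R, forall t, E t -> forall d : R, 0 < d ->
    exists M : R, forall x, E x -> d <= `|x - t| ->
      1 <= M * sq (expi (2 * pi / T * (x - t)) - 1)}.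

Section exponential_system.
Variable R : realType.
Notation mu := (@lebesgue_measure R).
Variables (E : set R) (T : R).
Hypothesis T0 : 0 < T.
Hypothesis mE : measurable E.
Hypothesis finE : (mu E < +oo)%E.
Let w := 2 * pi / T.

(** The [T]-periodic exponentials, restricted to [E]. *)
Definition ew (k : int) (x : R) : R[i] := ind E x * expi (2 * pi / T * k%:~R * x).

Hypothesis orth : forall k l, inner (ew k) (ew l) = (if k == l then T else 0)%:C.
Hypothesis sep : exp_separated E T.

Lemma sqint_ew k : sqint (ew k).
Proof.
rewrite /ew; under eq_fun do rewrite mulrC.
apply: sqint_unimodular; last exact: sqint_ind.
  apply: cmeasurable_expi; apply: measurable_funM => //.
by move=> x; rewrite sq_expi.
Qed.

Lemma ew0 : ew 0 = ind E.
Proof. by apply/funext => x; rewrite /ew mulr0 mul0r expi0 mulr1. Qed.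

Lemma ewB1 k x : ew k x * expi (- (w * x)) = ew (k - 1) x.
Proof.
rewrite /ew -mulrA -expiD; congr (_ * expi _).
by rewrite rmorphB /= mulrBr mulr1 mulrBl.
Qed.

Lemma sum_le_cvg0 (a : nat -> R) C : (forall n, 0 <= a n) ->
  (forall n, \sum_(0 <= i < n) a i <= C) -> a @ \oo --> (0 : R).
Proof.
move=> a0 aC; apply: cvg_series_cvg_0.
apply: (@nondecreasing_is_cvgn _ (series a)).
  by apply: nondecreasing_series => n _ _.
by exists C => _ [n _ <-]; exact: aC.
Qed.

(** The Riemann-Lebesgue property, here a consequence of Bessel's inequality. *)
Lemma coef_cvg0 g (iota_ : nat -> int) : injective iota_ -> sqint g ->
  (fun n => sq (coef ew T g (iota_ n))) @ \oo --> (0 : R).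
Proof.
move=> inj_i sg; apply: (@sum_le_cvg0 _ (nrm2 g / T)) => n; first exact: sq_ge0.
rewrite ler_pdivlMr// mulrC.
have := bessel T0 sqint_ew orth (s := map iota_ (index_iota 0 n)) _ sg.
by rewrite big_map; apply; rewrite map_inj_uniq// iota_uniq.
Qed.

Lemma sqV (z : R[i]) : sq z^-1 = (sq z)^-1.
Proof.
have [->|z0] := eqVneq z 0; first by rewrite invr0 sq0 invr0.
have sz : sq z != 0 by apply: contra_neq z0 => /sq_eq0.
by apply: (mulfI sz); rewrite -sqM !divff// sq1.
Qed.

Lemma cmeasurableV f : @cmeasurable R f -> cmeasurable (fun x => (f x)^-1).
Proof.
move=> mf.
(* 1 / z is the conjugate of z divided by its squared modulus, whose inverse is a
   real power. *)
have -> : (fun x => (f x)^-1) = (fun x => (f x)^* * (sq (f x) `^ (-1))%:C).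
  apply/funext => x; rewrite powR_inv1 ?sq_ge0//.
  by apply: complex_ext; rewrite !ReImE /=; case: (f x) => a b /=; rewrite /sq /=; ring.
apply: cmeasurableM; first exact: cmeasurableJ.
apply: cmeasurableC.
apply: (@measurableT_comp _ _ _ _ _ _ (fun y : R => y `^ (-1)) _ (fun x => sq (f x))).
  exact: measurable_powR.
exact: measurable_sq.
Qed.

Section jump.
Variable a : R.
(* The jump function whose Fourier series is studied. *)
Let f := ind (`]-oo, a[ `&` E).

Let sf : sqint f. Proof. by apply: sqint_indI. Qed.

Let S n := comb ew (idx n) (coef ew T f).

Section at_point.
Variables (t M : R).
Hypotheses (Et : E t) (ta : t != a).
Hypothesis sept : forall x, E x -> `|a - t| <= `|x - t| ->
  1 <= M * sq (expi (w * (x - t)) - 1).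

(* The quotient of f - f t by e^(i w (x - t)) - 1. Near t the numerator vanishes,
   because f is locally constant on E away from a; far from t the denominator is
   bounded below. So g is square-integrable. *)
Let g x := ind E x * (f x - f t) * (expi (w * (x - t)) - 1)^-1.

Let near_eq x : E x -> `|x - t| < `|a - t| -> f x = f t.
Proof.
move=> Ex xt; rewrite /f !ind_setI (ind1 Ex) (ind1 Et) !mulr1.
rewrite /ind !indicE; congr ((_ (nat_of_bool _))%:C).
rewrite !mem_setE !in_itv /=; move: xt ta.
case: (ltP x a); case: (ltP t a) => // ta' xa' + ta0.
- have [xt0 at0] : x - t <= 0 /\ a - t <= 0 by split; lra.
  by rewrite (ler0_norm xt0) (ler0_norm at0); lra.
- have [xt0 at0] : 0 <= x - t /\ 0 <= a - t by split; lra.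
  by rewrite (ger0_norm xt0) (ger0_norm at0); lra.
Qed.

Let gE x : ind E x * (f x - f t) = g x * (expi (w * (x - t)) - 1).
Proof.
have [Ex|Ex] := pselect (E x); last by rewrite /g (ind0 Ex) !mul0r.
have [xt|xt] := ltP `|x - t| `|a - t|.
  by rewrite /g near_eq// subrr mulr0 !mul0r.
have z0 : expi (w * (x - t)) - 1 != 0.
  apply/eqP => z0; have := sept Ex xt; rewrite z0 sq0 mulr0.
  by rewrite ler10.
by rewrite /g mulfVK.
Qed.

Let sg : sqint g.
Proof.
apply: (@sqint_le _ _ (fun x => `|M| * \1_E x)).
- apply: cmeasurableM; last first.
    apply: cmeasurableV; apply: cmeasurableB; last exact: cmeasurable_cst.
    apply: cmeasurable_expi; apply: measurable_funM => //.
    by apply: measurable_funB.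
  apply: cmeasurableM; first exact: cmeasurable_indic.
  by apply: cmeasurableB; [case: sf|exact: cmeasurable_cst].
- exact: (integrable_EFinZ _ (integrable_indic_fin mE finE)).
- move=> x; have [Ex|Ex] := pselect (E x); last first.
    by rewrite /g (ind0 Ex) !mul0r sq0 indicE memNset// mulr0.
  rewrite indicE mem_set// mulr1.
  have [xt|xt] := ltP `|x - t| `|a - t|.
    by rewrite /g near_eq// subrr mulr0 mul0r sq0.
  have M1 := sept Ex xt.
  have z0 : 0 < sq (expi (w * (x - t)) - 1).
    by rewrite lt_neqAle sq_ge0 andbT; apply/eqP => z0; move: M1; rewrite -z0 mulr0 ler10.
  rewrite /g (ind1 Ex) mul1r sqM sqV ler_pdivrMr//.
  apply: (@le_trans _ _ 1); last first.
    by apply: le_trans M1 _; rewrite ler_pM2r// ler_norm.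
  rewrite /f /ind !indicE -RC_N -RC_D sqC.
  by case: (_ \in _); case: (_ \in _) => /=; rewrite ?subrr ?subr0 ?sub0r ?sqrrN ?expr1n ?expr0n.
Qed.

Let b := coef ew T g.

(* On E one has f - f t = g (e^(i w (x - t)) - 1), and multiplication by
   e^(i w x) shifts the coefficients of g by one. *)
Let coefE k : coef ew T f k =
  f t * (k == 0)%:R + (expi (- (w * t)) * b (k - 1) - b k).
Proof.
have fE : f = fun x => f t * ew 0 x + (expi (- (w * t)) * (expi (w * x) * g x) - g x).
  apply/funext => x; rewrite ew0.
  have -> : expi (- (w * t)) * (expi (w * x) * g x) - g x =
      g x * (expi (w * (x - t)) - 1).
    rewrite (_ : w * (x - t) = - (w * t) + w * x) ?expiD; ring.
  rewrite -gE mulrBr [ind E x * f t]mulrC addrCA subrr addr0.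
  rewrite /f !ind_setI; have [Ex|Ex] := pselect (E x); first by rewrite (ind1 Ex) mul1r.
  by rewrite (ind0 Ex) mul0r mulr0.
have sxg : sqint (fun x => expi (w * x) * g x).
  apply: sqint_unimodular => //; last by move=> x; rewrite sq_expi.
  by apply: cmeasurable_expi; exact: measurable_funM.
have T0' : T%:C != 0 by rewrite eq_complex /= gt_eqF.
rewrite /coef {1}fE innerDl ?innerBl ?innerZl//; try exact: sqint_ew;
  try (by apply: sqintZ => //; exact: sqint_ew);
  try (by apply: sqintB => //; exact: sqintZ).
rewrite orth eq_sym.
have -> : inner (fun x => expi (w * x) * g x) (ew k) = inner g (ew (k - 1)).
  rewrite /inner; congr cintegral; apply/funext => x.
  by rewrite -ewB1 expiN conjcM conjc_conjc; ring.
rewrite /b /coef; case: eqP => _ /=; field => //.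
Qed.

(** Evaluated at [t], the terms of the Fourier series of [f - f t] telescope into
    two boundary terms, which are coefficients of the square-integrable function
    [g] up to a factor of modulus 1 and hence tend to 0. *)
Lemma partial_sums_cvg_at : cvgc (S^~ t) (f t).
Proof.
pose h k := b k * ew k t.
have SE n : S n t = f t + (h (Negz n) - h (Posz n)).
  rewrite /S /comb -idx_telescope.
  under eq_bigr do rewrite coefE mulrDl.
  rewrite big_split /=; congr (_ + _).
    rewrite (bigD1_seq 0) ?idx_uniq ?mem_idx//= ?eqxx mulr1 ew0 (ind1 Et) mulr1.
    by rewrite big1 ?addr0// => k /negbTE ->; rewrite mulr0 mul0r.
  by apply: eq_bigr => k _; rewrite /h -ewB1; ring.
have hcvg iota_ : injective iota_ -> cvgc (fun n => h (iota_ n)) 0.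
  move=> inj_i; apply: cvgc0.
  under eq_fun do rewrite /h sqM /ew (ind1 Et) mul1r sq_expi mulr1.
  exact: coef_cvg0.
under [S^~ t]funext do rewrite SE.
rewrite -[f t]addr0; apply: cvgcD; first by rewrite addr0; exact: cvgc_cst.
rewrite -(subr0 (0 : R[i])); by apply: cvgcB; apply: hcvg => p q [].
Qed.
End at_point.

Lemma partial_sums_cvg : {ae mu, forall t, cvgc (S^~ t) (f t)}.
Proof.
apply: (ae_imply2 sep (ae_neq a)) => t sept ta.
have [Et|Et] := pselect (E t); last first.
  apply: (@cvgc_near _ _ _ 0%N) => n _; rewrite /f ind_setI (ind0 Et) mulr0.
  by rewrite /S /comb big1// => k _; rewrite /ew (ind0 Et) mul0r mulr0.
have at0 : 0 < `|a - t| by rewrite normr_gt0 subr_eq0 eq_sym.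
have [M HM] := sept Et _ at0.
exact: (partial_sums_cvg_at Et ta (M := M)).
Qed.

(** The partial sums form a Cauchy sequence in L2 and converge a.e. to the jump
    function, which is therefore their limit in L2. *)
Lemma in_span_jump : in_span ew f.
Proof.
apply: (in_span_lim sqint_ew) => // eps eps0.
pose A n := T * \sum_(k <- idx n) sq (coef ew T f k).
have Amono n m : (n <= m)%N -> A n <= A m.
  move=> nm; rewrite -subr_ge0 -(nrm2_comb_tail T0 sqint_ew orth) ?idx_uniq//.
    exact: nrm2_ge0.
  exact: idx_mono.
have AC n : A n <= nrm2 f by exact: (bessel T0 sqint_ew orth (idx_uniq n)).
have [N HN] : exists N, forall n, (N <= n)%N -> A n - A N <= eps.
  have supA : has_sup (range A).
    by split; [exists (A 0%N), 0%N|exists (nrm2 f) => _ [n _ <-]].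
  have [_ [N _ <-] HN] := sup_adherent eps0 supA.
  exists N => n _; have : A n <= sup (range A) by apply: sup_upper_bound => //; exists n.
  by move: HN; lra.
have sS n : sqint (S n) by exact: (sqint_comb sqint_ew).
have [|_ fS] := nrm2_fatouB (N := N) (e := eps) sS (sS N) (proj1 sf) partial_sums_cvg.
  move=> n Nn; rewrite (nrm2_comb_tail T0 sqint_ew orth) ?idx_uniq//; last exact: idx_mono.
  exact: HN.
exists (S N) => //.
by apply: in_span_sum => [|k]; [exact: sqint_ew|apply: in_spanZ; [exact: sqint_ew|exact: in_span_gen sqint_ew _]].
Qed.
End jump.

Lemma in_span_exponentials f : sqint f -> (forall x, ~ E x -> f x = 0) ->
  in_span ew f.
Proof.
apply: (in_span_supported sqint_ew mE finE) => [|a]; last exact: in_span_jump.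
by rewrite -ew0; exact: in_span_gen sqint_ew 0.
Qed.

(** Completeness and the best approximation property give equality in the limit of
    Bessel's inequality. *)
Lemma parseval f : sqint f -> (forall x, ~ E x -> f x = 0) ->
  (fun n => T * \sum_(k <- idx n) sq (coef ew T f k)) @ \oo --> nrm2 f.
Proof.
move=> sf fE; apply/subr_cvg0/cvgr0Pnorm_le => eps eps0.
have [_ /(_ _ eps0)[l fl]] := in_span_exponentials sf fE.
have [N HN] := idx_cover (map snd l).
exists N => // n /= Nn; rewrite distrC ger0_norm; last first.
  by rewrite subr_ge0; exact: (bessel T0 sqint_ew orth (idx_uniq n)).
rewrite -(nrm2_sub_proj T0 sqint_ew orth) ?idx_uniq//.
apply: le_trans (ltW fl).
rewrite (@lcomb_comb _ _ ew l (idx n)) ?idx_uniq//; last first.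
  by move=> p pl; apply: HN => //; exact: map_f.
exact: (best_approximation T0 sqint_ew orth _ (idx_uniq n)).
Qed.
End exponential_system.

(** * Affine changes of variables and integrals of exponentials *)

Section affine_change_of_variables.
Variables (R : realType) (a b : R).
Notation mu := (@lebesgue_measure R).
Hypothesis a0 : 0 < a.
Let phi : measurableTypeR R -> measurableTypeR R := fun x => a * x + b.

Let mphi : measurable_fun setT phi.
Proof. by apply: measurable_funD => //; exact: measurable_funM. Qed.

Let nu : {measure set (measurableTypeR R) -> \bar R}.
Proof. refine (mscale (NngNum (ltW a0)) (pushforward mu phi)); exact: mphi. Defined.

(** Both measures agree on bounded intervals, and this characterises the Lebesgue
    measure. *)
Lemma lebesgue_measure_affine (A : set R) : measurable A -> mu A = nu A.
Proof.
move=> mA; apply: lebesgue_measure_unique => //= _ [[u v]] _ <-.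
transitivity (a%:E * mu (phi @^-1` `]u, v]))%E; last by [].
have -> : phi @^-1` `]u, v] = (`](u - b) / a, (v - b) / a]%classic : set (measurableTypeR R)).
  apply/seteqP; split => x; rewrite /phi /= !in_itv /= ltr_pdivrMr// ler_pdivlMr//;
    by rewrite ltrBlDr lerBrDr mulrC.
rewrite !lebesgue_measure_itv /= !lte_fin ltr_pM2r ?invr_gt0// ltrD2r.
case: ifP => _; last by rewrite mule0.
rewrite -!EFinB -EFinM; congr (_%:E).
have an0 : a != 0 by rewrite gt_eqF.
by field.
Qed.

Lemma ge0_integral_affine (f : R -> \bar R) : measurable_fun setT f ->
  (forall x, 0 <= f x)%E ->
  (\int[mu]_x f x = a%:E * \int[mu]_x f (a * x + b)%R)%E.
Proof.
move=> mf f0.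
rewrite (eq_measure_integral nu); last first.
  by move=> A mA _; exact: lebesgue_measure_affine.
by rewrite ge0_integral_mscale// ge0_integral_pushforward.
Qed.

Lemma integrable_affine (f : R -> R) : mu.-integrable setT (fun x => (f x)%:E) ->
  mu.-integrable setT (fun x => (f (a * x + b))%:E).
Proof.
move=> /integrableP[mf fi]; apply/integrableP; split.
  by apply: (measurableT_comp mf mphi).
move: fi; rewrite ge0_integral_affine//; last exact: measurableT_comp.
move: (\int[mu]_x _)%E (@integral_ge0 _ _ _ mu setT (fun x => `|(f (a * x + b))%:E|%E) (fun x _ => abse_ge0 _)).
case=> [r _ _|_|//]; first exact: ltry.
by rewrite gt0_muley ?lte_fin// ltxx.
Qed.

Lemma Rintegral_affine (f : R -> R) : mu.-integrable setT (fun x => (f x)%:E) ->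
  \int[mu]_x f (a * x + b) = a^-1 * \int[mu]_x f x.
Proof.
move=> fi; have gi := integrable_affine fi.
have mf : measurable_fun setT (fun x => (f x)%:E) by case/integrableP: fi.
rewrite /Rintegral; rewrite [in RHS]integralE [in LHS]integralE.
have E1 : (\int[mu]_x (fun x => (f x)%:E)^\+ x =
    a%:E * \int[mu]_x (fun x => (f (a * x + b))%:E)^\+ x)%E.
  rewrite (ge0_integral_affine (measurable_funepos mf)); last by move=> x; exact: funepos_ge0.
  by congr (_ * _)%E; apply: eq_integral => x _; rewrite !funeposE.
have E2 : (\int[mu]_x (fun x => (f x)%:E)^\- x =
    a%:E * \int[mu]_x (fun x => (f (a * x + b))%:E)^\- x)%E.
  rewrite (ge0_integral_affine (measurable_funeneg mf)); last by move=> x; exact: funeneg_ge0.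
  by congr (_ * _)%E; apply: eq_integral => x _; rewrite !funenegE.
rewrite E1 E2.
have fp := integrable_fin_num measurableT (integrable_funepos measurableT gi).
have fn := integrable_fin_num measurableT (integrable_funeneg measurableT gi).
rewrite -(fineK fp) -(fineK fn) -!EFinM -!EFinB /=.
have an0 : a != 0 by rewrite gt_eqF.
by field.
Qed.

Lemma cintegral_affine (f : R -> R[i]) : cintegrable f ->
  cintegral (fun x => f (a * x + b)) = (a^-1)%:C * cintegral f.
Proof.
move=> [rf jf]; apply: complex_ext; rewrite !ReImE /= mul0r ?subr0 ?addr0.
  exact: (Rintegral_affine (f := fun x => Re (f x))).
exact: (Rintegral_affine (f := fun x => Im (f x))).
Qed.
Lemma cmeasurable_affine (f : R -> R[i]) : cmeasurable f ->
  cmeasurable (fun x => f (a * x + b)).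
Proof.
by move=> [rf jf]; split; [exact: (measurableT_comp rf mphi)|exact: (measurableT_comp jf mphi)].
Qed.
Lemma sqint_affine (f : R -> R[i]) : sqint f -> sqint (fun x => f (a * x + b)).
Proof.
move=> [mf jf]; split; first exact: cmeasurable_affine.
exact: (integrable_affine (f := fun x => sq (f x))).
Qed.
Lemma nrm2_affine (f : R -> R[i]) : sqint f ->
  nrm2 (fun x => f (a * x + b)) = a^-1 * nrm2 f.
Proof. by move=> [mf jf]; exact: (Rintegral_affine (f := fun x => sq (f x))). Qed.
Lemma inner_affine (f g : R -> R[i]) : sqint f -> sqint g ->
  inner (fun x => f (a * x + b)) (fun x => g (a * x + b)) = (a^-1)%:C * inner f g.
Proof.
by move=> sf sg; rewrite -(cintegral_affine (cintegrable_mulJ sf sg)).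
Qed.
End affine_change_of_variables.

Section integrals_of_exponentials.
Variable R : realType.
Notation mu := (@lebesgue_measure R).
Implicit Types (a b s t : R).

Lemma integral_cos_itv a b s : a < b -> s != 0 ->
  \int[mu]_(x in `[a, b[) cos (s * x) = (sin (s * b) - sin (s * a)) / s.
Proof.
move=> ab s0; rewrite /Rintegral integral_itv_bndo_bndc; last first.
  apply/measurable_EFinP; apply: measurable_funTS.
  apply: measurableT_comp; last exact: measurable_funM.
  by apply: continuous_measurable_fun; exact: continuous_cos.
have dF x : is_derive x (1 : R) (s^-1 \*: (sin \o (s \*: id))) (cos (s * x)).
  apply: is_derive_eq; rewrite /GRing.scale /= mulr1.
  by rewrite [cos _ * s]mulrC mulKf.
have cF x : {for x, continuous (s^-1 \*: (sin \o (s \*: id)) : R -> R)}.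
  by apply: differentiable_continuous; apply/derivable1_diffP.
rewrite (@continuous_FTC2 _ _ (s^-1 \*: (sin \o (s \*: id)))) //.
- by rewrite /= /GRing.scale /=; ring.
- apply: continuous_subspaceT => x; apply: continuous_comp.
    by apply: continuousM; [exact: cst_continuous|exact: cvg_id].
  exact: continuous_cos.
- split; [move=> x _; exact: ex_derive|exact/cvg_at_right_filter/cF|exact/cvg_at_left_filter/cF].
- by move=> x _; rewrite derive1E; exact: derive_val.
Qed.

Lemma integral_sin_itv a b s : a < b -> s != 0 ->
  \int[mu]_(x in `[a, b[) sin (s * x) = (cos (s * a) - cos (s * b)) / s.
Proof.
move=> ab s0; rewrite /Rintegral integral_itv_bndo_bndc; last first.
  apply/measurable_EFinP; apply: measurable_funTS.
  apply: measurableT_comp; last exact: measurable_funM.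
  by apply: continuous_measurable_fun; exact: continuous_sin.
have dF x : is_derive x (1 : R) ((- s^-1) \*: (cos \o (s \*: id))) (sin (s * x)).
  apply: is_derive_eq; rewrite /GRing.scale /= mulr1.
  by rewrite !mulNr mulrN opprK mulrCA mulVf// mulr1.
have cF x : {for x, continuous ((- s^-1) \*: (cos \o (s \*: id)) : R -> R)}.
  by apply: differentiable_continuous; apply/derivable1_diffP.
rewrite (@continuous_FTC2 _ _ ((- s^-1) \*: (cos \o (s \*: id)))) //.
- by rewrite /= /GRing.scale /=; ring.
- apply: continuous_subspaceT => x; apply: continuous_comp.
    by apply: continuousM; [exact: cst_continuous|exact: cvg_id].
  exact: continuous_sin.
- split; [move=> x _; exact: ex_derive|exact/cvg_at_right_filter/cF|exact/cvg_at_left_filter/cF].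
- by move=> x _; rewrite derive1E; exact: derive_val.
Qed.

Lemma Rintegral_ind (A : set R) (h : R -> R) :
  \int[mu]_x (\1_A x * h x) = \int[mu]_(x in A) h x.
Proof.
rewrite [RHS]Rintegral_mkcond; congr Rintegral; apply/funext => x.
by rewrite /patch indicE; case: (_ \in _); rewrite ?mul1r ?mul0r.
Qed.

Lemma cintegral_expi_itv a b s : a < b -> s != 0 ->
  cintegral (fun x => ind `[a, b[ x * expi (s * x)) =
  (expi (s * b) - expi (s * a)) * (0 -i* s^-1).
Proof.
move=> ab s0; apply: complex_ext; rewrite !ReImE /=.
  under eq_Rintegral do rewrite mul0r subr0.
  by rewrite Rintegral_ind integral_cos_itv//; ring.
under eq_Rintegral do rewrite mul0r addr0.
by rewrite Rintegral_ind integral_sin_itv//; ring.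
Qed.

Lemma cintegral_ind_itv a b : a < b -> cintegral (ind `[a, b[) = (b - a)%:C.
Proof.
move=> ab; apply: complex_ext => /=; last by rewrite /Rintegral integral0.
under eq_Rintegral do rewrite -[\1_ _ _]mulr1.
rewrite Rintegral_ind Rintegral_cst// mul1r /= lebesgue_measure_itv /= lte_fin ab.
by rewrite -EFinB.
Qed.

Lemma expi_eq1 s : expi s = 1 -> exists k : int, s = 2 * pi * k%:~R.
Proof.
move=> s1; have p0 : 0 < 2 * pi :> R by rewrite mulr_gt0// pi_gt0.
pose k := Num.floor (s / (2 * pi)); exists k.
pose r := s - 2 * pi * k%:~R.
have /andP[r0 r2] : 0 <= r < 2 * pi.
  have /andP[k1 k2] := floor_itv (s / (2 * pi)).
  rewrite /r subr_ge0 mulrC -ler_pdivlMr// k1 /= ltrBlDl.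
  move: k2; rewrite ltr_pdivrMr// intrD mulrDl mul1r -/k => k2.
  by [].
have er : expi r = 1.
  by rewrite /r expiD s1 mul1r -mulrN -rmorphN expi2pi.
apply/eqP; rewrite -subr_eq0 -/r; apply/eqP; apply/eqP/negPn/negP => rn0.
have rp : 0 < r by rewrite lt_neqAle eq_sym rn0.
(* If 0 < r < 2 pi then cos r = 1 - 2 (sin (r / 2)) ^ 2 < 1. *)
have sp : 0 < sin (r / 2) by apply: sin_gt0_pi; apply/andP; split; lra.
have : cos r = 1 by move/(congr1 (fun z : R[i] => Re z)): er.
have -> : r = (r / 2) *+ 2 by rewrite -mulr_natr divfK.
by rewrite cos_mulr2n cos2sin2; nra.
Qed.
End integrals_of_exponentials.

Section separation.
Variable R : realType.
Notation mu := (@lebesgue_measure R).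

(** On the compact set of the [x] in [C] at distance at least [d] from [t], the
    continuous function |e^(2 pi i (x - t) / T) - 1|^2 has no zero, hence a positive
    minimum; [M] is its inverse. *)
Lemma separated_compact (E C : set R) (T : R) : E `<=` C -> compact C ->
  {ae mu, forall t, E t -> forall x, C x ->
     expi (2 * pi / T * (x - t)) = 1 -> x = t} ->
  exp_separated E T.
Proof.
move=> EC cC H; apply: (ae_imply H) => t Ht Et d d0.
pose D := C `&` [set x | d <= `|x - t|].
have cD : compact D.
  apply: compact_closedI => //.
  apply: (@preimage_closed _ _ (fun x : R => `|x - t|) [set y | d <= y]); last exact: closed_ge.
  move=> x _; apply: cvg_norm; apply: cvgB; [exact: cvg_id|exact: cvg_cst].
have [[x0 D0]|nD] := pselect (D !=set0); last first.
  by exists 0 => x /EC Cx xt; exfalso; apply: nD; exists x.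
have [c /set_mem[Cc dc] cmin] : exists2 c, c \in D & forall x, x \in D ->
    sq (expi (2 * pi / T * (c - t)) - 1) <= sq (expi (2 * pi / T * (x - t)) - 1).
  apply: (compact_EVT_min (f := fun x => sq (expi (2 * pi / T * (x - t)) - 1))) => //.
    by exists x0.
  apply: continuous_subspaceT => x.
  have cl : {for x, continuous (fun x => 2 * pi / T * (x - t))}.
    apply: cvgM; first exact: cvg_cst.
    by apply: cvgB; [exact: cvg_id|exact: cvg_cst].
  have -> : (fun x => sq (expi (2 * pi / T * (x - t)) - 1)) =
     (fun x => (cos (2 * pi / T * (x - t)) - 1) ^+ 2 + (sin (2 * pi / T * (x - t))) ^+ 2).
    by apply/funext => y; rewrite /sq !ReImE /= oppr0 addr0.
  have cc : {for x, continuous (fun x => cos (2 * pi / T * (x - t)))}.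
    by apply: continuous_comp => //; exact: continuous_cos.
  have cs : {for x, continuous (fun x => sin (2 * pi / T * (x - t)))}.
    by apply: continuous_comp => //; exact: continuous_sin.
  have cc1 : {for x, continuous (fun x => cos (2 * pi / T * (x - t)) - 1)}.
    by apply: cvgB; [exact: cc|exact: cvg_cst].
  by apply: cvgD; rewrite /=; apply: cvgM.
have c0 : 0 < sq (expi (2 * pi / T * (c - t)) - 1).
  rewrite lt_neqAle sq_ge0 andbT; apply/negP => /eqP /esym /sq_eq0 /eqP.
  rewrite subr_eq0 => /eqP /(Ht Et _ Cc) ct.
  by move: dc; rewrite /= ct subrr normr0 leNgt d0.
exists (sq (expi (2 * pi / T * (c - t)) - 1))^-1 => x Ex xt.
rewrite -[leLHS](mulVf (negbT (gt_eqF c0))) ler_wpM2l ?invr_ge0 ?sq_ge0//.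
by apply: cmin; rewrite inE; split => //; exact: EC.
Qed.
End separation.

(** * The Plancherel identity for boundedly supported functions *)

Section interval_exponentials.
Variables (R : realType) (c : R).
Notation mu := (@lebesgue_measure R).
Hypothesis c0 : 0 < c.
Let E : set R := `[- c, c[%classic.
Let T := 2 * c.

Lemma int_small (k : int) : `|k%:~R : R| < 1 -> k = 0.
Proof.
by move=> k1; apply/eqP; rewrite -normr_le0 -ltzD1 add0r -(ltr_int R) intr_norm.
Qed.

Lemma finite_itv (a b : R) : (mu `[a, b[ < +oo)%E.
Proof. by rewrite lebesgue_measure_itv /=; case: ifP => _; rewrite -?EFinB ltry. Qed.

(** Only the difference of the two frequencies matters. *)
Lemma inner_ew (E' : set R) (T' : R) k l :
  inner (ew E' T' k) (ew E' T' l) =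
  cintegral (fun x => ind E' x * expi (2 * pi / T' * (k - l)%:~R * x)).
Proof.
congr cintegral; apply/funext => x; rewrite /ew conjcM -expiN.
rewrite ind_conj mulrACA -expiD -ind_setI setIid; congr (_ * expi _).
by rewrite intrB; ring.
Qed.

Lemma interval_orth k l : inner (ew E T k) (ew E T l) = (if k == l then T else 0)%:C.
Proof.
rewrite inner_ew; case: eqP => [->|/eqP kl].
  under eq_fun do rewrite subrr mulr0 mul0r expi0 mulr1.
  by rewrite cintegral_ind_itv ?gtrN//; congr (_%:C); rewrite /T; ring.
have s0 : 2 * pi / T * (k - l)%:~R != 0 :> R.
  rewrite mulf_neq0 ?intr_eq0 ?subr_eq0// mulf_neq0 ?invr_neq0// /T.
    by rewrite mulf_neq0// gt_eqF// pi_gt0.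
  by rewrite mulf_neq0// gt_eqF.
rewrite cintegral_expi_itv ?gtrN//.
have -> : 2 * pi / T * (k - l)%:~R * c = 2 * pi / T * (k - l)%:~R * - c + 2 * pi * (k - l)%:~R.
  by rewrite /T; field; rewrite gt_eqF.
by rewrite expiD expi2pi mulr1 subrr mul0r.
Qed.

Lemma interval_separated : exp_separated E T.
Proof.
apply: (@separated_compact _ _ `[- c, c]%classic).
- by move=> x; rewrite /E /= !in_itv /= => /andP[cx xc]; rewrite cx ltW.
- exact: segment_compact.
apply: (ae_imply (ae_neq (- c))) => t tc.
rewrite /E /= in_itv /= => /andP[ct tc'] x; rewrite in_itv /= => /andP[cx xc].
move=> /expi_eq1[k]; have p0 : pi != 0 :> R by rewrite gt_eqF// pi_gt0.
have ltct : - c < t by rewrite lt_neqAle eq_sym tc.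
move=> kE; have {}kE : x - t = T * k%:~R.
  have T0 : T != 0 by rewrite /T mulf_neq0// gt_eqF.
  have w0 : 2 * pi / T != 0 by rewrite !mulf_neq0 ?invr_neq0.
  by apply: (mulfI w0); rewrite kE mulrA divfK.
suff k0 : k = 0 by apply/eqP; rewrite -subr_eq0 kE k0 mulr0.
apply: int_small; rewrite -(ltr_pM2l (_ : 0 < T)) ?mulr_gt0// mulr1.
rewrite -{1}(gtr0_norm (_ : 0 < T)) ?mulr_gt0// -normrM -kE ltr_norml /T.
apply/andP; split; lra.
Qed.
End interval_exponentials.

Section fourier_L1.
Variable R : realType.
Notation mu := (@lebesgue_measure R).
Implicit Types (f g : R -> R[i]).

(** A substitute for the modulus, within a factor [sqrt 2] of it, whose
    integrability is immediate from that of the two parts. *)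
Definition cabs (z : R[i]) : R := `|Re z| + `|Im z|.

Lemma cabs_ge0 z : 0 <= cabs z. Proof. by rewrite addr_ge0. Qed.
Lemma sq_le_cabs z : sq z <= cabs z ^+ 2.
Proof.
rewrite /sq /cabs -[Re z ^+ 2]real_normK ?num_real// -[Im z ^+ 2]real_normK ?num_real//.
by have := normr_ge0 (Re z); have := normr_ge0 (Im z); nra.
Qed.
Lemma cabs_le_sq z : cabs z ^+ 2 <= 2 * sq z.
Proof.
rewrite /cabs /sq -[Re z ^+ 2]real_normK ?num_real// -[Im z ^+ 2]real_normK ?num_real//.
by have := sqr_ge0 (`|Re z| - `|Im z|); rewrite sqrrB; nra.
Qed.
Lemma integrable_cabs f : cintegrable f -> mu.-integrable setT (fun x => (cabs (f x))%:E).
Proof.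
move=> [rf jf]; rewrite (_ : (fun x => _) = (fun x => `|Re (f x)|%:E + `|Im (f x)|%:E)%E)//.
by apply: integrableD => //; exact: (integrable_norm (f := _)).
Qed.

Lemma cintegrable_unimodular f (h : R -> R) : measurable_fun setT h ->
  cintegrable f -> cintegrable (fun x => f x * expi (h x)).
Proof.
move=> mh jf; apply: (cintegrable_dominated _ (integrable_cabs jf)).
- by apply: cmeasurableM; [exact: cintegrable_measurable|exact: cmeasurable_expi].
- by move=> x; exact: cabs_ge0.
- by move=> x; rewrite sqM sq_expi mulr1 sq_le_cabs.
Qed.

Lemma cintegrable_kernel f xi : cintegrable f ->
  cintegrable (fun x => f x * expi (- (xi * x))).
Proof.
apply: cintegrable_unimodular; apply: measurableT_comp => //; exact: measurable_funM.
Qed.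

Lemma fourierD f g xi : cintegrable f -> cintegrable g ->
  fourier (fun x => f x + g x) xi = fourier f xi + fourier g xi.
Proof.
move=> jf jg; rewrite /fourier; under eq_fun do rewrite mulrDl.
by rewrite cintegralD//; exact: cintegrable_kernel.
Qed.
Lemma fourierZ c f xi : cintegrable f ->
  fourier (fun x => c * f x) xi = c * fourier f xi.
Proof.
move=> jf; rewrite /fourier; under eq_fun do rewrite -mulrA.
by rewrite cintegralZ//; exact: cintegrable_kernel.
Qed.
Lemma fourierB f g xi : cintegrable f -> cintegrable g ->
  fourier (fun x => f x - g x) xi = fourier f xi - fourier g xi.
Proof.
move=> jf jg; rewrite -mulN1r -fourierZ// -fourierD//; last exact: cintegrableZ.
by under [in RHS]eq_fun do rewrite mulN1r.
Qed.

Lemma continuous_cos_mul (y : R) (l : R) : {for l, continuous (fun l : R => cos (l * y))}.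
Proof.
apply: continuous_comp; last exact: continuous_cos.
by apply: cvgM; [exact: cvg_id|exact: cvg_cst].
Qed.
Lemma continuous_sin_mul (y : R) (l : R) : {for l, continuous (fun l : R => sin (l * y))}.
Proof.
apply: continuous_comp; last exact: continuous_sin.
by apply: cvgM; [exact: cvg_id|exact: cvg_cst].
Qed.

Lemma continuous_fourier_part (p q : R -> R) : mu.-integrable setT (fun x => (p x)%:E) ->
  mu.-integrable setT (fun x => (q x)%:E) ->
  continuous (fun xi : R => \int[mu]_x (p x * cos (xi * x) + q x * sin (xi * x))).
Proof.
move=> ip iq xi.
have mpq l : measurable_fun setT (fun x => p x * cos (l * x) + q x * sin (l * x)).
  have mp : measurable_fun setT p by apply/measurable_EFinP; exact: (measurable_int mu).
  have mq : measurable_fun setT q by apply/measurable_EFinP; exact: (measurable_int mu).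
  apply: measurable_funD; apply: measurable_funM => //.
    apply: measurableT_comp; last exact: measurable_funM.
    by apply: continuous_measurable_fun; exact: continuous_cos.
  apply: measurableT_comp; last exact: measurable_funM.
  by apply: continuous_measurable_fun; exact: continuous_sin.
have ig : mu.-integrable setT (EFin \o (fun x => `|p x| + `|q x|)).
  rewrite (_ : EFin \o _ = (fun x => `|p x|%:E + `|q x|%:E)%E)//.
  by apply: integrableD => //; exact: (integrable_norm (f := _)).
have le_g l x : `|p x * cos (l * x) + q x * sin (l * x)| <= `|p x| + `|q x|.
  apply: (le_trans (ler_normD _ _)); rewrite !normrM lerD// ler_piMr//.
    by rewrite ler_norml cos_geN1 cos_le1.
  by rewrite ler_norml sin_geN1 sin_le1.
apply: (@continuity_under_integral R _ _ mu (fun l x => p x * cos (l * x) + q x * sin (l * x))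
  setT measurableT (xi - 1) (xi + 1) _ _ (fun x => `|p x| + `|q x|)) => //.
- move=> l _; apply: (le_integrable measurableT _ _ ig); first by apply/measurable_EFinP; exact: mpq.
  by move=> x _ /=; rewrite lee_fin [leRHS]ger0_norm ?addr_ge0.
- apply: aeW => x _ l _; apply: cvgD; apply: cvgM; try exact: cvg_cst.
    exact: continuous_cos_mul.
  exact: continuous_sin_mul.
- by move=> l _; apply: aeW => x _; exact: le_g.
- by rewrite inE /= in_itv /=; apply/andP; split; lra.
Qed.

(** The Fourier integral is a continuous function of the frequency. *)
Lemma cmeasurable_fourier f : cintegrable f -> cmeasurable (fourier f).
Proof.
move=> [rf jf]; split; apply: continuous_measurable_fun.
  have -> : (fun xi => Re (fourier f xi)) =
    (fun xi => \int[mu]_x (Re (f x) * cos (xi * x) + Im (f x) * sin (xi * x))).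
    apply/funext => xi; apply: eq_Rintegral => x _.
    by rewrite RecM /= cosN sinN mulrN opprK.
  exact: continuous_fourier_part.
have -> : (fun xi => Im (fourier f xi)) =
    (fun xi => \int[mu]_x (Im (f x) * cos (xi * x) + (- Re (f x)) * sin (xi * x))).
  apply/funext => xi; apply: eq_Rintegral => x _.
  by rewrite ImcM /= cosN sinN mulrN mulNr addrC.
apply: continuous_fourier_part => //.
by under eq_fun do rewrite EFinN; apply: integrableN.
Qed.

Lemma cintegral_dominated (F_ : nat -> R -> R[i]) (F : R -> R[i]) (h : R -> R) :
  (forall n, cmeasurable (F_ n)) -> (forall x, cvgc (F_^~ x) (F x)) ->
  mu.-integrable setT (fun x => (h x)%:E) -> (forall n x, cabs (F_ n x) <= h x) ->
  cintegrable F -> cvgc (fun n => cintegral (F_ n)) (cintegral F).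
Proof.
move=> mF FF ih leh [rF jF]; split => /=.
  apply: fine_cvg; rewrite fineK ?integrable_fin_num//.
  apply: (@dominated_cvg _ _ _ mu _ measurableT (fun n x => (Re (F_ n x))%:E) _ (fun x => (h x)%:E)) => //.
  - by move=> n; apply/measurable_EFinP; case: (mF n).
  - by move=> x _; have [cx _] := FF x; exact: cvg_comp cx _.
  - by move=> n x _ /=; rewrite lee_fin (le_trans _ (leh n x))// lerDl.
apply: fine_cvg; rewrite fineK ?integrable_fin_num//.
apply: (@dominated_cvg _ _ _ mu _ measurableT (fun n x => (Im (F_ n x))%:E) _ (fun x => (h x)%:E)) => //.
- by move=> n; apply/measurable_EFinP; case: (mF n).
- by move=> x _; have [_ cx] := FF x; exact: cvg_comp cx _.
- by move=> n x _ /=; rewrite lee_fin (le_trans _ (leh n x))// lerDr.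
Qed.
End fourier_L1.

Lemma ler_sum_subset (R : numDomainType) (I : eqType) (s t : seq I) (F : I -> R) :
  uniq s -> uniq t -> {subset s <= t} -> (forall i, 0 <= F i) ->
  \sum_(i <- s) F i <= \sum_(i <- t) F i.
Proof.
move=> us ut st F0; rewrite [leRHS](bigID (fun i => i \in s)) /= -[X in _ <= X + _]big_filter.
rewrite [X in _ <= X + _](perm_big s); first by rewrite lerDl sumr_ge0.
apply: uniq_perm => //; first exact: filter_uniq.
by move=> i; rewrite mem_filter; case: (boolP (i \in s)) => //= /st.
Qed.

Section plancherel_compact.
Variables (R : realType) (c : R).
Notation mu := (@lebesgue_measure R).
Hypothesis c0 : 0 < c.
Let E : set R := `[- c, c[%classic.
Let T := 2 * c.
Let w := 2 * pi / T.
Variable f : R -> R[i].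
Hypothesis sf : sqint f.
Hypothesis fE : forall x, ~ E x -> f x = 0.

Let T0 : 0 < T. Proof. by rewrite mulr_gt0. Qed.
Let w0 : 0 < w. Proof. by rewrite divr_gt0// mulr_gt0// pi_gt0. Qed.

Lemma cintegrable_supported : cintegrable f.
Proof.
have -> : f = fun x => f x * (ind E x)^*.
  apply/funext => x; have [Ex|Ex] := pselect (E x).
    by rewrite (ind1 Ex) rmorph1 mulr1.
  by rewrite fE// mul0r.
by apply: cintegrable_mulJ => //; apply: sqint_ind; [exact: measurable_itv|exact: (finite_itv (- c) c)].
Qed.
Let jf := cintegrable_supported.

Let G (xi : R) : R := sq (fourier f xi).

Let mG : measurable_fun setT G.
Proof. by apply: measurable_sq; exact: cmeasurable_fourier. Qed.
Let G0 xi : 0 <= G xi. Proof. exact: sq_ge0. Qed.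

(* Parseval for e^(- i s x) f over the interval E of length T: the samples of the
   Fourier transform on any translate of the grid w Z have the same square sum. *)
Let sampled (s : R) :
  (fun n => \sum_(k <- idx n) G (s + w * k%:~R)) @ \oo --> T * nrm2 f.
Proof.
pose fs x := expi (- (s * x)) * f x.
have ms : measurable_fun setT (fun x : R => - (s * x)).
  by apply: measurableT_comp => //; exact: measurable_funM.
have sfs : sqint fs.
  by apply: sqint_unimodular => [|x|//]; [exact: cmeasurable_expi|rewrite sq_expi].
have nfs : nrm2 fs = nrm2 f.
  by rewrite /nrm2; apply: eq_Rintegral => x _; rewrite sqM sq_expi mul1r.
have fsE x : ~ E x -> fs x = 0 by move=> /fE; rewrite /fs => ->; rewrite mulr0.
have coefE k : sq (coef (ew E T) T fs k) = T ^- 2 * G (s + w * k%:~R).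
  rewrite /coef sqM sqV sqC mulrC; congr (_ * sq _).
  rewrite /inner /fourier; congr cintegral; apply/funext => x.
  rewrite /fs /ew conjcM -expiN.
  have [Ex|Ex] := pselect (E x); last by rewrite fE// mulr0 !mul0r.
  rewrite (ind1 Ex) rmorph1 mul1r mulrAC -expiD mulrC; congr (_ * expi _).
  by rewrite -/w; ring.
have := parseval T0 (measurable_itv _) (finite_itv _ _) (interval_orth c0)
  (interval_separated c0) sfs fsE.
rewrite nfs => H.
have -> : (fun n => \sum_(k <- idx n) G (s + w * k%:~R)) =
    (fun n => T * (T * \sum_(k <- idx n) sq (coef (ew E T) T fs k))).
  apply/funext => n; rewrite mulrA mulr_sumr; apply: eq_bigr => k _.
  by rewrite coefE; field; rewrite gt_eqF.
by apply: cvgM => //; exact: cvg_cst.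
Qed.

Let D : set R := `[0, w[%classic.

(* The translates of [0, w[ by multiples of w tile the line, the real number xi
   lying in the one of index floor (xi / w). *)
Let period_integral n :
  (\int[mu]_s (\1_D s * \sum_(k <- idx n) G (s + w * k%:~R))%:E =
   \int[mu]_xi ((Num.floor (xi / w) \in idx n)%:R * G xi)%:E)%E.
Proof.
have mD : measurable D by exact: measurable_itv.
have mshift (k : int) : measurable_fun setT (fun s : R => G (s + w * k%:~R)).
  by apply: (measurableT_comp mG); exact: measurable_funD.
have mterm (k : int) : measurable_fun setT (fun s : R => (\1_D s * G (s + w * k%:~R))%:E).
  by apply/measurable_EFinP; apply: measurable_funM => //; exact: measurable_indic.
have term0 (k : int) (s : R) : (0 <= (\1_D s * G (s + w * k%:~R))%:E)%E.
  by rewrite lee_fin mulr_ge0.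
under eq_integral do rewrite mulr_sumr -sumEFin.
rewrite ge0_integral_sum//.
have floorE (xi : R) (k : int) :
    \1_D (1 * xi + - (w * k%:~R)) = (k == Num.floor (xi / w))%:R :> R.
  rewrite indicE mem_setE /= in_itv /= mul1r subr_ge0 ltrBlDl eq_sym floor_eq.
  by rewrite ler_pdivlMr// ltr_pdivrMr// intrD mulrDl mul1r ![_ * w]mulrC.
under eq_bigr => k _ do rewrite (ge0_integral_affine (- (w * k%:~R)) (@ltr01 R))// mul1e.
have mterm' (k : int) : measurable_fun setT (fun xi : R =>
    (\1_D (1 * xi + - (w * k%:~R)) * G (1 * xi + - (w * k%:~R) + w * k%:~R))%:E).
  apply: (measurableT_comp (mterm k)).
  by apply: measurable_funD => //; exact: measurable_funM.
rewrite -ge0_integral_sum//.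
apply: eq_integral => xi _; rewrite sumEFin; congr (_%:E).
under eq_bigr do rewrite floorE mul1r subrK.
rewrite -mulr_suml; congr (_ * _).
have [xn|xn] := boolP (_ \in _).
  rewrite (bigD1_seq (Num.floor (xi / w))) ?idx_uniq//= eqxx big1 ?addr0// => k /negbTE ->//.
rewrite big1_seq// => k /andP[_ kn]; case: eqP => // kE.
by move: xn; rewrite -kE kn.
Qed.

(** Integrating the identity [sampled] over one period of the sampling grid turns the
    sums over the grid into an integral over the line; the constant is
    [w * T = 2 * pi]. *)
Lemma plancherel_compact : sqint (fourier f) /\ nrm2 (fourier f) = 2 * pi * nrm2 f.
Proof.
have mD : measurable D by exact: measurable_itv.
have msum n : measurable_fun setT (fun s : R => \sum_(k <- idx n) G (s + w * k%:~R)).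
  elim: (idx n) => [|k r IH]; first by under eq_fun do rewrite big_nil; exact: measurable_cst.
  under eq_fun do rewrite big_cons; apply: measurable_funD => //.
  by apply: (measurableT_comp mG); exact: measurable_funD.
have H1 : (fun n => \int[mu]_s (\1_D s * \sum_(k <- idx n) G (s + w * k%:~R))%:E)%E @ \oo -->
    (2 * pi * nrm2 f)%:E.
  have -> : (2 * pi * nrm2 f)%:E = (\int[mu]_s limn (fun n =>
      (\1_D s * \sum_(k <- idx n) G (s + w * k%:~R))%:E))%E.
    transitivity (\int[mu]_s ((T * nrm2 f)%:E * (\1_D s)%:E))%E.
      rewrite ge0_integralZl//; last 2 first.
      - by apply/measurable_EFinP; exact: measurable_indic.
      - by rewrite lee_fin mulr_ge0 ?nrm2_ge0// ltW.
      rewrite integral_indic// setIT /D /= lebesgue_measure_itv /= lte_fin w0 -EFinB subr0 -EFinM.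
      by congr (_%:E); rewrite /w; field; rewrite gt_eqF.
    apply: eq_integral => s _; apply/esym/cvg_lim => //.
    rewrite -EFinM mulrC; apply: cvg_EFin; first by near=> n.
    by apply: cvgM; [exact: cvg_cst|exact: sampled].
  apply: cvg_monotone_convergence => //.
  - by move=> n; apply/measurable_EFinP; apply: measurable_funM; [exact: measurable_indic|exact: msum].
  - by move=> n s _; rewrite lee_fin mulr_ge0// sumr_ge0.
  - move=> s _ n m nm; rewrite lee_fin ler_wpM2l//.
    by apply: ler_sum_subset; rewrite ?idx_uniq//; exact: idx_mono.
have mfloor n : measurable_fun setT (fun xi : R => (Num.floor (xi / w) \in idx n)%:R : R).
  have -> : (fun xi : R => (Num.floor (xi / w) \in idx n)%:R : R) =
      \1_([set xi : R | Num.floor (xi / w) \in idx n]).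
    by apply/funext => xi; rewrite indicE mem_setE.
  apply: measurable_indic.
  have -> : [set xi : R | Num.floor (xi / w) \in idx n] =
      \big[setU/set0]_(k <- idx n) `[k%:~R * w, (k + 1)%:~R * w[%classic.
    rewrite -bigcup_seq; apply/seteqP; split => xi /=.
      move=> xin; exists (Num.floor (xi / w)) => //=.
      have /andP[] := floor_itv (xi / w); rewrite ler_pdivlMr// ltr_pdivrMr// in_itv /=.
      by move=> -> ->.
    move=> [k /= kn]; rewrite in_itv /= -ler_pdivlMr// -ltr_pdivrMr// -floor_eq.
    by move=> /eqP ->.
  by apply: bigsetU_measurable => k _; exact: measurable_itv.
have H2 : (fun n => \int[mu]_xi ((Num.floor (xi / w) \in idx n)%:R * G xi)%:E)%E @ \oo -->
    (\int[mu]_xi (G xi)%:E)%E.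
  have -> : (\int[mu]_xi (G xi)%:E)%E = (\int[mu]_xi limn (fun n =>
      ((Num.floor (xi / w) \in idx n)%:R * G xi)%:E))%E.
    apply: eq_integral => xi _; apply/esym/cvg_lim => //.
    apply: cvg_EFin; first by near=> n.
    have [N HN] := idx_cover [:: Num.floor (xi / w)].
    apply: cvg_near_cst; exists N => // n /= /HN /(_ _ (mem_head _ _)) ->.
    by rewrite /= mul1r.
  apply: cvg_monotone_convergence => //.
  - by move=> n; apply/measurable_EFinP; apply: measurable_funM; [exact: mfloor|exact: mG].
  - by move=> n xi _; rewrite lee_fin mulr_ge0.
  - move=> xi _ n m nm; rewrite lee_fin ler_wpM2r//.
    by case: (boolP (_ \in idx n)) => [/(idx_mono nm) ->|].
have GE : (\int[mu]_xi (G xi)%:E)%E = (2 * pi * nrm2 f)%:E.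
  have := cvg_lim (@ereal_hausdorff R) H2.
  under eq_fun do rewrite -period_integral.
  by rewrite (cvg_lim (@ereal_hausdorff R) H1) => ->.
have sF : sqint (fourier f).
  split; first exact: cmeasurable_fourier.
  apply/integrableP; split; first exact/measurable_EFinP.
  under eq_integral do rewrite gee0_abs ?lee_fin ?sq_ge0//.
  by rewrite [X in (X < _)%E]GE ltry.
by split => //; rewrite /nrm2 /Rintegral GE.
Unshelve. all: by end_near. Qed.
End plancherel_compact.

(** * The Fourier transform on L2 *)

Section truncation.
Variable R : realType.
Notation mu := (@lebesgue_measure R).
Implicit Types (f g u : R -> R[i]).

Definition window (n : nat) : set R := `[- n.+1%:R, n.+1%:R[%classic.
Definition wcut n u (x : R) : R[i] := ind (window n) x * u x.

Lemma window_cover (x : R) : exists N, forall n, (N <= n)%N -> window n x.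
Proof.
exists (Num.truncn `|x|) => n Nn; rewrite /window /= in_itv /=.
have : `|x| < n.+1%:R.
  by apply: (lt_le_trans (truncnS_gt _)); rewrite ler_nat ltnS.
by rewrite ltr_norml => /andP[/ltW -> ->].
Qed.

Lemma window_sub n m : (n <= m)%N -> window n `<=` window m.
Proof.
move=> nm x; rewrite /window /= !in_itv /= => /andP[a b].
have nm' : n.+1%:R <= m.+1%:R :> R by rewrite ler_nat.
by apply/andP; split; [apply: le_trans a; rewrite lerN2|exact: lt_le_trans nm'].
Qed.

Lemma sqint_window n u : sqint u -> sqint (wcut n u).
Proof. by move=> su; apply: sqint_cut => //; exact: measurable_itv. Qed.

Lemma cut_supported n u (x : R) : ~ window n x -> wcut n u x = 0.
Proof. by move=> nx; rewrite /wcut ind0// mul0r. Qed.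

Lemma cut_near u x : exists N, forall n, (N <= n)%N -> wcut n u x = u x.
Proof.
by have [N HN] := window_cover x; exists N => n /HN nx; rewrite /wcut ind1// mul1r.
Qed.

Lemma nrm2_window_cvg u : sqint u ->
  (fun n => nrm2 (fun x => wcut n u x - u x)) @ \oo --> (0 : R).
Proof.
move=> su; apply: nrm2_cut_cvg => // [n|x]; first exact: measurable_itv.
exact: cut_near.
Qed.

Lemma cintegrable_window n u : sqint u -> cintegrable (wcut n u).
Proof.
by move=> su; apply: (cintegrable_supported (sqint_window n su)) => x; exact: cut_supported.
Qed.

Lemma plancherel_window n u : sqint u ->
  sqint (fourier (wcut n u)) /\ nrm2 (fourier (wcut n u)) = 2 * pi * nrm2 (wcut n u).
Proof.
move=> su; apply: (@plancherel_compact _ n.+1%:R) => //; first exact: sqint_window.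
by move=> x; exact: cut_supported.
Qed.

(** The transforms of the truncations of [u] converge pointwise because [u] is
    integrable, and they form a Cauchy sequence in L2 by the case of bounded
    support; hence they converge in L2 to the transform of [u]. *)
Lemma plancherel_L1_L2 u : cintegrable u -> sqint u ->
  sqint (fourier u) /\ nrm2 (fourier u) = 2 * pi * nrm2 u.
Proof.
move=> iu su.
have ptw xi : cvgc (fun n => fourier (wcut n u) xi) (fourier u xi).
  apply: (@cintegral_dominated _ _ _ (fun x => 2 * cabs (u x))).
  - by move=> n; apply: cintegrable_measurable; apply: cintegrable_kernel; exact: cintegrable_window.
  - move=> x; have [N HN] := cut_near u x.
    by apply: (@cvgc_near _ _ _ N) => n /HN ->.
  - by apply: integrable_EFinZ; exact: integrable_cabs.
  - move=> n x; set z := wcut n u x * _.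
    have sz : sq z <= sq (u x).
      rewrite /z sqM sq_expi mulr1 /wcut sqM sqC indicE.
      by case: (_ \in _); rewrite ?expr1n ?mul1r// expr0n mul0r sq_ge0.
    rewrite -ler_sqr ?nnegrE ?cabs_ge0 ?mulr_ge0 ?cabs_ge0//.
    apply: (le_trans (cabs_le_sq z)); rewrite exprMn.
    have := sq_le_cabs (u x); have := sq_ge0 z; nra.
  - exact: cintegrable_kernel.
have sF n : sqint (fourier (wcut n u)) by have [] := plancherel_window n su.
have bound m n : (m <= n)%N ->
    nrm2 (fun xi => fourier (wcut n u) xi - fourier (wcut m u) xi) <=
    2 * pi * nrm2 (fun x => wcut m u x - u x).
  move=> mn; rewrite nrm2_swap.
  have -> : (fun xi => fourier (wcut m u) xi - fourier (wcut n u) xi) =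
      fourier (wcut n (fun x => wcut m u x - u x)).
    apply/funext => xi; rewrite -fourierB; try exact: cintegrable_window.
    congr fourier; apply/funext => x; rewrite /wcut mulrBr mulrA -ind_setI.
    by rewrite (setIidr (window_sub mn)).
  have sd : sqint (fun x => wcut m u x - u x) by apply: sqintB => //; exact: sqint_window.
  have [_ ->] := plancherel_window n sd.
  rewrite ler_pM2l ?mulr_gt0 ?pi_gt0//; apply: nrm2_dom => //.
    by have [] := sqint_window n sd.
  move=> x; rewrite /wcut sqM sqC indicE.
  by case: (_ \in _); rewrite ?expr1n ?mul1r// expr0n mul0r sq_ge0.
have pi2 : 0 < 2 * pi :> R by rewrite mulr_gt0// pi_gt0.
have aeptw : {ae mu, forall xi, cvgc (fun n => fourier (wcut n u) xi) (fourier u xi)}.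
  exact: aeW.
have [sFu _] := nrm2_fatouB sF (sF 0%N) (cmeasurable_fourier iu) aeptw
  (fun n (_ : (0 <= n)%N) => bound 0%N n (leq0n n)).
split => //.
have cF : (fun n => nrm2 (fun xi => fourier (wcut n u) xi - fourier u xi)) @ \oo --> (0 : R).
  apply: eps_cvg0 => [n|e e0]; first exact: nrm2_ge0.
  have [N HN] := cvg0_eps (nrm2_window_cvg su) (divr_gt0 e0 pi2).
  exists N => n Nn; rewrite nrm2_swap.
  have [_ h] := nrm2_fatouB sF (sF n) (cmeasurable_fourier iu) aeptw (bound n).
  apply: (le_trans h); rewrite mulrC -ler_pdivlMr//; exact: ltW (HN n Nn).
have lim1 := nrm2_cvg sF sFu cF.
have lim2 : (fun n => nrm2 (fourier (wcut n u))) @ \oo --> 2 * pi * nrm2 u.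
  under eq_fun do rewrite (plancherel_window _ su).2.
  apply: cvgM; first exact: cvg_cst.
  by apply: nrm2_cvg => // [n|]; [exact: sqint_window|exact: nrm2_window_cvg].
by rewrite -(cvg_lim (@Rhausdorff R) lim1) (cvg_lim (@Rhausdorff R) lim2).
Qed.
End truncation.

Section multiplication_formula.
Variable R : realType.
Notation mu := (@lebesgue_measure R).
Variables (u H : R -> R[i]).
Hypotheses (iu : cintegrable u) (iH : cintegrable H).

(* The integrand of the double integral whose order is exchanged. *)
Let F (p : R * R) : R[i] := u p.1 * H p.2 * expi (- (p.2 * p.1)).

Let cmeasurable2 (h : R * R -> R[i]) := measurable_fun setT (fun p => Re (h p)) /\
  measurable_fun setT (fun p => Im (h p)).

Let cmeasurable2M h k : cmeasurable2 h -> cmeasurable2 k -> cmeasurable2 (fun p => h p * k p).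
Proof.
move=> [rh jh] [rk jk]; split.
  by under eq_fun do rewrite RecM; apply: measurable_funB; exact: measurable_funM.
by under eq_fun do rewrite ImcM; apply: measurable_funD; exact: measurable_funM.
Qed.

Let mF : cmeasurable2 F.
Proof.
have [ru ju] := cintegrable_measurable iu; have [rH jH] := cintegrable_measurable iH.
apply: cmeasurable2M; first apply: cmeasurable2M.
- by split; [exact: (measurableT_comp ru (@measurable_fst _ _ _ _))
            |exact: (measurableT_comp ju (@measurable_fst _ _ _ _))].
- by split; [exact: (measurableT_comp rH (@measurable_snd _ _ _ _))
            |exact: (measurableT_comp jH (@measurable_snd _ _ _ _))].
- have mp : measurable_fun setT (fun p : R * R => - (p.2 * p.1)).
    apply: measurableT_comp => //; apply: measurable_funM.
      exact: measurable_snd.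
    exact: measurable_fst.
  split => /=; apply: measurableT_comp => //; apply: continuous_measurable_fun;
    [exact: continuous_cos|exact: continuous_sin].
Qed.

Let absF (p : R * R) : cabs (F p) <= 2 * cabs (u p.1) * cabs (H p.2).
Proof.
rewrite -ler_sqr ?nnegrE ?mulr_ge0 ?cabs_ge0//.
apply: (le_trans (cabs_le_sq _)); rewrite /F !sqM sq_expi mulr1 !exprMn.
have h1 := sq_le_cabs (u p.1); have h2 := sq_le_cabs (H p.2).
have g1 := sq_ge0 (u p.1); have g2 := sq_ge0 (H p.2).
have : sq (u p.1) * sq (H p.2) <= cabs (u p.1) ^+ 2 * cabs (H p.2) ^+ 2 by exact: ler_pM.
have := sqr_ge0 (cabs (u p.1)); have := sqr_ge0 (cabs (H p.2)); nra.
Qed.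

(* Here q is the real or the imaginary part. *)
Let integrable_part (q : R[i] -> R) : (forall z, `|q z| <= cabs z) ->
  measurable_fun setT (fun p => q (F p)) ->
  (mu \x mu)%E.-integrable setT (fun p => (q (F p))%:E).
Proof.
move=> qle mq; apply/integrable12ltyP; first exact/measurable_EFinP.
pose CH := \int[mu]_xi cabs (H xi).
have iCH : (\int[mu]_xi (cabs (H xi))%:E)%E = CH%:E.
  by rewrite /CH /Rintegral fineK// integrable_fin_num//; exact: integrable_cabs.
have mcu : measurable_fun setT (fun x => cabs (u x)).
  by apply/measurable_EFinP; exact: (measurable_int mu) (integrable_cabs iu).
have mcH : measurable_fun setT (fun x => cabs (H x)).
  by apply/measurable_EFinP; exact: (measurable_int mu) (integrable_cabs iH).
have inner_le x : (\int[mu]_xi `|(q (F (x, xi)))%:E| <= (2 * cabs (u x) * CH)%:E)%E.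
  rewrite EFinM -iCH -ge0_integralZl//; last 3 first.
  - exact/measurable_EFinP.
  - by move=> xi _; rewrite lee_fin cabs_ge0.
  - by rewrite lee_fin mulr_ge0 ?cabs_ge0.
  apply: ge0_le_integral => //.
  - apply: measurableT_comp => //; apply/measurable_EFinP.
    exact: (measurableT_comp mq (pair1_measurable x)).
  - by apply/measurable_EFinP; exact: measurable_funM.
  - by move=> xi _; rewrite lee_fin (le_trans (qle _))// (absF (x, xi)).
have CH0 : 0 <= CH by apply: Rintegral_ge0 => xi _; exact: cabs_ge0.
apply: (@le_lt_trans _ _ (\int[mu]_x (2 * cabs (u x) * CH)%:E)%E).
  apply: ge0_le_integral => //.
  - by move=> x _; apply: integral_ge0.
  - apply: (@measurable_fun_fubini_tonelli_F _ _ _ _ _ mu (fun p => `|(q (F p))%:E|%E)) => //.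
    by apply: measurableT_comp => //; exact/measurable_EFinP.
  - by apply/measurable_EFinP; apply: measurable_funM => //; exact: measurable_funM.
have : mu.-integrable setT (fun x => (CH * (2 * cabs (u x)))%:E).
  by do 2 apply: integrable_EFinZ; exact: integrable_cabs.
move=> /(integrable_fin_num measurableT); rewrite fin_numE => /andP[_].
by under eq_integral do rewrite mulrC; rewrite ltey.
Qed.

Let fubini_part (q : R[i] -> R) : (forall z, `|q z| <= cabs z) ->
  measurable_fun setT (fun p => q (F p)) ->
  (forall x, mu.-integrable setT (fun xi => (q (F (x, xi)))%:E)) ->
  (forall xi, mu.-integrable setT (fun x => (q (F (x, xi)))%:E)) ->
  \int[mu]_x (\int[mu]_xi q (F (x, xi))) = \int[mu]_xi (\int[mu]_x q (F (x, xi))).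
Proof.
move=> qle mq i1 i2; have ip := integrable_part qle mq.
rewrite {1}/Rintegral [RHS]/Rintegral; congr fine.
under eq_integral do rewrite /Rintegral fineK ?integrable_fin_num//.
under [RHS]eq_integral do rewrite /Rintegral fineK ?integrable_fin_num//.
exact: (Fubini ip).
Qed.

Lemma multiplication_formula :
  cintegral (fun xi => fourier u xi * H xi) = cintegral (fun x => u x * fourier H x).
Proof.
have E1 xi : fourier u xi * H xi = cintegral (fun x => F (x, xi)).
  rewrite mulrC -cintegralZ; last exact: cintegrable_kernel.
  by congr cintegral; apply/funext => x; rewrite /F /=; ring.
have E2 x : u x * fourier H x = cintegral (fun xi => F (x, xi)).
  rewrite -cintegralZ; last exact: cintegrable_kernel.
  by congr cintegral; apply/funext => xi; rewrite /F /= [xi * x]mulrC; ring.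
have I1 xi : cintegrable (fun x => F (x, xi)).
  have := cintegrableZ (H xi) (cintegrable_kernel xi iu); congr cintegrable.
  by apply/funext => x; rewrite /F /=; ring.
have I2 x : cintegrable (fun xi => F (x, xi)).
  have := cintegrableZ (u x) (cintegrable_kernel x iH); congr cintegrable.
  by apply/funext => xi; rewrite /F /= [xi * x]mulrC; ring.
under eq_fun do rewrite E1; under [in RHS]eq_fun do rewrite E2.
case: mF => mr mi; apply: complex_ext => /=.
  apply/esym; apply: (fubini_part (q := fun z => Re z)) => //.
  - by move=> z; rewrite lerDl.
  - by move=> x; case: (I2 x).
  - by move=> xi; case: (I1 xi).
apply/esym; apply: (fubini_part (q := fun z => Im z)) => //.
- by move=> z; rewrite lerDr.
- by move=> x; case: (I2 x).
- by move=> xi; case: (I1 xi).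
Qed.
End multiplication_formula.

Section fourier_pairs.
Variable R : realType.
Notation mu := (@lebesgue_measure R).
Implicit Types (f g h u : R -> R[i]).

Lemma L2norm_integral h : L2norm h = ((\int[mu]_x (sq (h x))%:E) `^ 2^-1)%E.
Proof.
rewrite /L2norm unlock; congr (_ `^ _)%E; apply: eq_integral => x _.
rewrite normc_sq gee0_abs ?lee_fin ?sqrtr_ge0// poweR_EFin.
by rewrite -[2]/(2%:R) powR_mulrn ?sqrtr_ge0// sqr_sqrtr// sq_ge0.
Qed.

Lemma L2norm_nrm2 h : sqint h -> L2norm h = (Num.sqrt (nrm2 h))%:E.
Proof.
by move=> sh; rewrite L2norm_integral nrm2_EFin// poweR_EFin powR12_sqrt ?nrm2_ge0.
Qed.

Lemma L2_sqint h : L2 h <-> sqint h.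
Proof.
split=> [[mh hlt]|sh]; last by split; [case: sh|rewrite L2norm_nrm2// ltry].
split => //; apply/integrableP; split.
  by apply/measurable_EFinP; exact: measurable_sq.
under eq_integral do rewrite gee0_abs ?lee_fin ?sq_ge0//.
move: hlt; rewrite L2norm_integral.
have : (0 <= \int[mu]_x (sq (h x))%:E)%E.
  by apply: integral_ge0 => x _; rewrite lee_fin sq_ge0.
case: (\int[mu]_x (sq (h x))%:E)%E => [r _ _|_|//]; first exact: ltry.
by rewrite poweRyr ?ltxx//.
Qed.

Lemma L2norm_cvg0 (h_ : nat -> R -> R[i]) : (forall n, sqint (h_ n)) ->
  (fun n => L2norm (h_ n)) @ \oo --> 0%E <-> (fun n => nrm2 (h_ n)) @ \oo --> (0 : R).
Proof.
move=> sh; under eq_fun do rewrite L2norm_nrm2//; split=> H.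
  have {}H : (fun n => Num.sqrt (nrm2 (h_ n))) @ \oo --> (0 : R) by exact: (fine_cvg H).
  have -> : (fun n => nrm2 (h_ n)) =
      (fun n => Num.sqrt (nrm2 (h_ n)) * Num.sqrt (nrm2 (h_ n))).
    by apply/funext => n; rewrite -expr2 sqr_sqrtr// nrm2_ge0.
  by rewrite -(mulr0 (0 : R)); exact: (cvgM H H).
apply: cvg_EFin; first by near=> n.
rewrite -(@sqrtr0 R).
exact: (continuous_cvg _ (@sqrt_continuous R 0) H).
Unshelve. all: by end_near. Qed.

Lemma fourierL2P f g : fourierL2 f g <-> [/\ sqint f, sqint g &
  exists u : nat -> R -> R[i],
    [/\ forall n, cintegrable (u n) /\ sqint (u n),
        (fun n => nrm2 (fun x => u n x - f x)) @ \oo --> (0 : R) &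
        (fun n => nrm2 (fun xi => fourier (u n) xi - g xi)) @ \oo --> (0 : R)]].
Proof.
split=> -[sf sg [u [iu cu cF]]].
  move/L2_sqint : sf => sf; move/L2_sqint : sg => sg; split => //; exists u.
  have {}iu n : cintegrable (u n) /\ sqint (u n).
    by have [? /L2_sqint] := iu n.
  have sF n : sqint (fourier (u n)) by apply plancherel_L1_L2; case: (iu n).
  by split => //; apply/L2norm_cvg0 => // n; apply: sqintB => //; case: (iu n).
have sF n : sqint (fourier (u n)) by apply plancherel_L1_L2; case: (iu n).
split; [exact/L2_sqint|exact/L2_sqint|exists u].
split; last 2 first.
- by apply/L2norm_cvg0 => // n; apply: sqintB => //; case: (iu n).
- by apply/L2norm_cvg0 => // n; apply: sqintB.
- by move=> n; case: (iu n) => ? ?; split => //; apply/L2_sqint.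
Qed.

Lemma fourierL2_plancherel f g : fourierL2 f g -> nrm2 g = 2 * pi * nrm2 f.
Proof.
move=> /fourierL2P[sf sg [u [iu cu cF]]].
have sF n : sqint (fourier (u n)) by apply plancherel_L1_L2; case: (iu n).
have lim1 := nrm2_cvg sF sg cF.
have lim2 : (fun n => nrm2 (fourier (u n))) @ \oo --> 2 * pi * nrm2 f.
  have -> : (fun n => nrm2 (fourier (u n))) = (fun n => 2 * pi * nrm2 (u n)).
    by apply/funext => n; have [iun sun] := iu n; have [_ ->] := plancherel_L1_L2 iun sun.
  apply: cvgM; first exact: cvg_cst.
  by apply: nrm2_cvg => // n; case: (iu n).
by rewrite -(cvg_lim (@Rhausdorff R) lim1) (cvg_lim (@Rhausdorff R) lim2).
Qed.

Lemma nrm2D_cvg0 (h_ k_ : nat -> R -> R[i]) :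
  (forall n, sqint (h_ n)) -> (forall n, sqint (k_ n)) ->
  (fun n => nrm2 (h_ n)) @ \oo --> (0 : R) -> (fun n => nrm2 (k_ n)) @ \oo --> (0 : R) ->
  (fun n => nrm2 (fun x => h_ n x + k_ n x)) @ \oo --> (0 : R).
Proof.
move=> sh sk ch ck; apply: eps_cvg0 => [n|e e0]; first exact: nrm2_ge0.
have e4 : 0 < e / 4 by rewrite divr_gt0.
have [N HN] := cvg0_eps ch e4; have [M HM] := cvg0_eps ck e4.
exists (maxn N M) => n; rewrite geq_max => /andP[/HN hn /HM kn].
apply: (le_trans (nrm2D_le (sh n) (sk n))); lra.
Qed.

Lemma fourierL2D f1 g1 f2 g2 : fourierL2 f1 g1 -> fourierL2 f2 g2 ->
  fourierL2 (fun x => f1 x + f2 x) (fun xi => g1 xi + g2 xi).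
Proof.
move=> /fourierL2P[sf1 sg1 [u [iu cu cF]]] /fourierL2P[sf2 sg2 [v [iv cv cG]]].
have sF n : sqint (fourier (u n)) by apply plancherel_L1_L2; case: (iu n).
have sG n : sqint (fourier (v n)) by apply plancherel_L1_L2; case: (iv n).
apply/fourierL2P; split; [exact: sqintD|exact: sqintD|].
exists (fun n x => u n x + v n x); split.
- move=> n; have [iun sun] := iu n; have [ivn svn] := iv n.
  by split; [exact: cintegrableD|exact: sqintD].
- under eq_fun do under [X in nrm2 X]eq_fun do rewrite opprD addrACA.
  by apply: nrm2D_cvg0 => // n; apply: sqintB => //; [case: (iu n)|case: (iv n)].
- under eq_fun => n.
    have [iun sun] := iu n; have [ivn svn] := iv n.
    under [X in nrm2 X]eq_fun do rewrite fourierD// opprD addrACA.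
    over.
  by apply: nrm2D_cvg0 => // n; apply: sqintB.
Qed.

Lemma fourierL2Z c f g : fourierL2 f g ->
  fourierL2 (fun x => c * f x) (fun xi => c * g xi).
Proof.
move=> /fourierL2P[sf sg [u [iu cu cF]]].
have sF n : sqint (fourier (u n)) by apply plancherel_L1_L2; case: (iu n).
apply/fourierL2P; split; [exact: sqintZ|exact: sqintZ|].
exists (fun n x => c * u n x); split.
- by move=> n; have [iun sun] := iu n; split; [exact: cintegrableZ|exact: sqintZ].
- have -> : (fun n => nrm2 (fun x => c * u n x - c * f x)) =
      (fun n => sq c * nrm2 (fun x => u n x - f x)).
    apply/funext => n; rewrite -nrm2Z; last by apply: sqintB => //; case: (iu n).
    by congr nrm2; apply/funext => x; rewrite mulrBr.
  by rewrite -(mulr0 (sq c)); apply: cvgM => //; exact: cvg_cst.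
- have -> : (fun n => nrm2 (fun xi => fourier (fun x => c * u n x) xi - c * g xi)) =
      (fun n => sq c * nrm2 (fun x => fourier (u n) x - g x)).
    apply/funext => n; rewrite -nrm2Z; last exact: sqintB.
    congr nrm2; apply/funext => x; rewrite mulrBr fourierZ//; by case: (iu n).
  by rewrite -(mulr0 (sq c)); apply: cvgM => //; exact: cvg_cst.
Qed.

Lemma fourierL2_0 : fourierL2 (fun=> 0 : R[i]) (fun=> 0 : R[i]).
Proof.
have s0 := @sqint0 R.
have n0 : (fun n : nat => nrm2 (fun x : R => (0 : R[i]) - 0)) @ \oo --> (0 : R).
  by under eq_fun do rewrite /nrm2 /Rintegral subrr sq0 integral0 /=; exact: cvg_cst.
apply/fourierL2P; split => //; exists (fun _ _ => 0); split => //.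
  by move=> _; split => //; split; exact: integrable0.
have -> : fourier (fun=> 0) = (fun=> 0 : R[i]).
  apply/funext => xi; rewrite /fourier; under eq_fun do rewrite mul0r.
  by apply: complex_ext; rewrite /= /Rintegral integral0.
exact: n0.
Qed.

Lemma fourierL2_lcomb (I : Type) (e d : I -> R -> R[i]) l :
  (forall i, fourierL2 (e i) (d i)) -> fourierL2 (lcomb e l) (lcomb d l).
Proof.
move=> ed; rewrite /lcomb; elim: l => [|p l IH].
  under eq_fun do rewrite big_nil; under [X in fourierL2 _ X]eq_fun do rewrite big_nil.
  exact: fourierL2_0.
under eq_fun do rewrite big_cons; under [X in fourierL2 _ X]eq_fun do rewrite big_cons.
by apply: fourierL2D => //; exact: fourierL2Z.
Qed.

Lemma fourierL2B f1 g1 f2 g2 : fourierL2 f1 g1 -> fourierL2 f2 g2 ->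
  fourierL2 (fun x => f1 x - f2 x) (fun xi => g1 xi - g2 xi).
Proof.
move=> H1 /(fourierL2Z (-1)) H2; have := fourierL2D H1 H2.
by under eq_fun do rewrite mulN1r; under [X in fourierL2 _ X]eq_fun do rewrite mulN1r.
Qed.

(** Polarisation: the Plancherel identity for [f1 + f2] gives the real parts, and
    the same for ['i * f1] the imaginary parts. *)
Lemma fourierL2_inner f1 g1 f2 g2 : fourierL2 f1 g1 -> fourierL2 f2 g2 ->
  inner g1 g2 = (2 * pi)%:C * inner f1 f2.
Proof.
move=> H1 H2.
have [sf2 sg2 _] := (fourierL2P _ _).1 H2.
have Re_eq f g : fourierL2 f g -> Re (inner g g2) = 2 * pi * Re (inner f f2).
  move=> H; have [sf sg _] := (fourierL2P _ _).1 H.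
  have := fourierL2_plancherel (fourierL2D H H2).
  rewrite !nrm2D// (fourierL2_plancherel H) (fourierL2_plancherel H2); lra.
have [sf1 sg1 _] := (fourierL2P _ _).1 H1.
apply: complex_ext; first by rewrite (Re_eq _ _ H1) RecM /= mul0r subr0.
have := Re_eq _ _ (fourierL2Z 'i%C H1).
by rewrite !innerZl// !RecM ImcM /=; lra.
Qed.

(** The inverse Fourier integral. *)
Definition ift (G : R -> R[i]) (x : R) : R[i] :=
  ((2 * pi)^-1)%:C * cintegral (fun xi => G xi * expi (xi * x)).

Lemma ift_fourier G (x : R) : cintegrable G ->
  ift G x = ((2 * pi)^-1)%:C * (fourier (fun xi => (G xi)^*) x)^*.
Proof.
move=> iG; rewrite /ift /fourier -cintegralJ; last by apply: cintegrable_kernel; exact: cintegrableJ.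
congr (_ * cintegral _); apply/funext => xi.
by rewrite conjcM conjc_conjc -expiN opprK mulrC [x * xi]mulrC mulrC.
Qed.

(** Let [f] be [ift G]. Up to a constant, [f] is the conjugate of the transform of
    the conjugate of [G], so that 2 pi |f|^2 = |G|^2 in L2 norm. For the truncations
    [u n] of [f], the multiplication formula shows that the inner product of the
    transform of [u n] with [G] is 2 pi |u n|^2. Therefore the transform of [u n]
    is at squared distance 2 pi (|f|^2 - |u n|^2) from [G], which tends to 0. *)
Lemma fourierL2_ift c (G : R -> R[i]) : 0 < c -> sqint G ->
  (forall xi, ~ `[- c, c[%classic xi -> G xi = 0) -> fourierL2 (ift G) G.
Proof.
move=> c0 sG GE.
have iG : cintegrable G by exact: (cintegrable_supported sG GE).
pose Gc xi := (G xi)^*.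
have sGc : sqint Gc by exact: sqintJ.
have GcE xi : ~ `[- c, c[%classic xi -> Gc xi = 0.
  by move=> /GE; rewrite /Gc => ->; exact: rmorph0.
have [sFGc nFGc] := plancherel_compact c0 sGc GcE.
have iE : ift G = fun x => ((2 * pi)^-1)%:C * (fourier Gc x)^*.
  by apply/funext => x; exact: ift_fourier.
have sf : sqint (ift G) by rewrite iE; apply: sqintZ; exact: sqintJ.
have p0 : 2 * pi != 0 :> R by rewrite mulf_neq0// gt_eqF// pi_gt0.
have nf : 2 * pi * nrm2 (ift G) = nrm2 G.
  rewrite iE nrm2Z; last exact: sqintJ.
  have -> : nrm2 (fun x => (fourier Gc x)^*) = nrm2 (fourier Gc).
    by rewrite /nrm2; under eq_Rintegral do rewrite sqJ.
  have -> : nrm2 G = nrm2 Gc by rewrite /nrm2; under [RHS]eq_Rintegral do rewrite sqJ.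
  by rewrite nFGc sqC; move: (2 * pi) p0 => p p0; field.
pose u n := wcut n (ift G).
have su n : sqint (u n) by exact: sqint_window.
have iu n : cintegrable (u n) by exact: cintegrable_window.
have sFu n : sqint (fourier (u n)) by have [] := plancherel_window n sf.
apply/fourierL2P; split => //; exists u; split => //; first exact: nrm2_window_cvg.
have innE n : inner (fourier (u n)) G = (2 * pi * nrm2 (u n))%:C.
  rewrite /inner (multiplication_formula (iu n) (cintegrableJ iG)).
  have -> : (fun x => u n x * fourier (fun xi => (G xi)^*) x) =
      (fun x => (2 * pi)%:C * (u n x * (u n x)^*)).
    apply/funext => x; rewrite /u /wcut iE -/Gc !conjcM conjc_conjc.
    rewrite ind_conj conjcR.
    have ii : ind (window n) x * ind (window n) x = ind (window n) x :> R[i].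
      by rewrite -ind_setI setIid.
    have pp : (2 * pi)%:C * ((2 * pi)^-1)%:C = 1 :> R[i] by rewrite -RC_M divff.
    transitivity ((2 * pi)%:C * ((2 * pi)^-1)%:C * (ind (window n) x * ind (window n) x) *
      (((2 * pi)^-1)%:C * (fourier Gc x)^*) * fourier Gc x); last by ring.
    by rewrite pp ii mul1r.
  rewrite cintegralZ; last exact: cintegrable_mulJ.
  by rewrite [RHS]RC_M -(inner_nrm2 (u n)).
have -> : (fun n => nrm2 (fun xi => fourier (u n) xi - G xi)) =
    (fun n => 2 * pi * (nrm2 (ift G) - nrm2 (u n))).
  apply/funext => n; rewrite nrm2B// innE -nf /=.
  by have [_ ->] := plancherel_window n sf; rewrite -/(u n); ring.
rewrite -(mulr0 (2 * pi)) -(subrr (nrm2 (ift G))).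
apply: cvgM; first exact: cvg_cst.
apply: cvgB; first exact: cvg_cst.
by apply: nrm2_cvg => //; exact: nrm2_window_cvg.
Qed.
End fourier_pairs.

(** * The set K modulo translations and dilations *)

Section wavelet_set.
Variables (R : realType) (x y : R).
Notation mu := (@lebesgue_measure R).
Hypotheses (hpx : pi < x) (hxy : x < y) (hy : y < 2 * pi) (hgap : 2 * y < x + 2 * pi).

Let pi0 : 0 < pi :> R. Proof. exact: pi_gt0. Qed.
Let tau0 : 0 < 2 * pi :> R. Proof. by rewrite mulr_gt0. Qed.

(* Comparison of endpoints: linear arithmetic from the constraints on x and y. *)
Local Ltac tlra :=
  move: (hpx) (hxy) (hy) (hgap) (pi0) => ? ? ? ? ?; lra.

Definition pieces : seq (R * R) :=
  [:: (x, y); (2 * pi, 2 * x); (2 * y, x + 2 * pi);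
      (y + 2 * pi, 4 * pi); (2 * x + 4 * pi, 2 * y + 4 * pi)].

(** [Kset x y] without the right endpoints of its five pieces, so that its dilates
    by powers of 2 cover the half-line exactly once. *)
Definition Kh : set R :=
  `[x, y[ `|` `[2 * pi, 2 * x[ `|` `[2 * y, x + 2 * pi[
  `|` `[y + 2 * pi, 4 * pi[ `|` `[2 * x + 4 * pi, 2 * y + 4 * pi[.

Lemma measurable_Kh : measurable Kh.
Proof. by do 4?[apply: measurableU]. Qed.

Lemma Kh_bounds t : Kh t -> x <= t < 8 * pi.
Proof.
by move=> [[[[|]|]|]|] /=; rewrite in_itv /= => /andP[a b]; apply/andP; split; tlra.
Qed.

Lemma Kh_gt0 t : Kh t -> 0 < t.
Proof. by move=> /Kh_bounds /andP[a _]; tlra. Qed.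

Lemma finite_Kh : (mu Kh < +oo)%E.
Proof.
apply: (@le_lt_trans _ _ (mu `[x, 8 * pi[)); last exact: finite_itv.
apply: le_measure; rewrite ?inE; [exact: measurable_Kh|exact: measurable_itv|].
by move=> t /Kh_bounds tb; rewrite /= in_itv.
Qed.

Lemma ind_setU (A B : set R) t : (A t -> B t -> False) ->
  ind (A `|` B) t = ind A t + ind B t.
Proof.
move=> AB; have [At|At] := pselect (A t).
  rewrite (ind1 At) (ind0 (AB At)) addr0 ind1//; by left.
have [Bt|Bt] := pselect (B t); first by rewrite (ind1 Bt) (ind0 At) add0r ind1//; right.
by rewrite (ind0 At) (ind0 Bt) addr0 ind0// => -[].
Qed.

Lemma ind_Kh t : ind Kh t = \sum_(p <- pieces) ind `[p.1, p.2[ t.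
Proof.
rewrite /Kh !ind_setU ?big_cons ?big_nil ?addr0 ?addrA//; rewrite /= !in_itv /=.
- by move=> /andP[? ?] /andP[? ?]; tlra.
- by move=> [|] /andP[? ?] /andP[? ?]; tlra.
- by move=> [[|]|] /andP[? ?] /andP[? ?]; tlra.
- by move=> [[[|]|]|] /andP[? ?] /andP[? ?]; tlra.
Qed.

(** When [k != l], the integral over each piece is a difference of values of a
    [2 * pi]-periodic function at its endpoints; modulo [2 * pi] the endpoints
    cancel in pairs. When [k = l], the lengths of the pieces add up to [2 * pi]. *)
Lemma Kh_orth k l : inner (ew Kh (2 * pi) k) (ew Kh (2 * pi) l) =
  (if k == l then 2 * pi else 0)%:C.
Proof.
rewrite inner_ew.
have fin_int (p : R * R) (s : R) :
    cintegrable (fun t => ind `[p.1, p.2[ t * expi (s * t)).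
  apply: cintegrable_unimodular; first exact: measurable_funM.
  split; last by rewrite /=; exact: integrable0.
  by apply: integrable_indic_fin; [exact: measurable_itv|exact: finite_itv].
have -> : (fun t => ind Kh t * expi (2 * pi / (2 * pi) * (k - l)%:~R * t)) =
    (fun t => \sum_(p <- pieces) ind `[p.1, p.2[ t * expi ((k - l)%:~R * t)).
  apply/funext => t; rewrite ind_Kh mulr_suml; apply: eq_bigr => p _.
  by rewrite divff ?mul1r// gt_eqF.
rewrite (cintegral_sum pieces (fun p => fin_int p _)).1.
rewrite /pieces !big_cons big_nil /=.
case: eqP => [->|/eqP kl].
  have E (a b : R) : a < b ->
      cintegral (fun t => ind `[a, b[ t * expi ((l - l)%:~R * t)) = (b - a)%:C.
    move=> ab; rewrite -cintegral_ind_itv//; congr cintegral; apply/funext => t.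
    by rewrite subrr mul0r expi0 mulr1.
  rewrite !E; [|tlra|tlra|tlra|tlra|tlra].
  rewrite -!RC_D addr0; congr (_%:C); ring.
set s : R := (k - l)%:~R.
have s0 : s != 0 by rewrite intr_eq0 subr_eq0.
have [l1 l2 l3] : [/\ x < y, 2 * pi < 2 * x & 2 * y < x + 2 * pi] by split; tlra.
have [l4 l5] : y + 2 * pi < 4 * pi /\ 2 * x + 4 * pi < 2 * y + 4 * pi by split; tlra.
rewrite !cintegral_expi_itv//.
have per (t : R) (m : int) : expi (s * (t + 2 * pi * m%:~R)) = expi (s * t).
  rewrite mulrDr expiD [s * (_ * _)]mulrCA -intrM.
  by rewrite -[X in _ * X]/(expi (2 * pi * _)) expi2pi mulr1.
have p1 t : expi (s * (t + 2 * pi)) = expi (s * t).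
  by have := per t 1; rewrite mulr1.
have p2 t : expi (s * (t + 4 * pi)) = expi (s * t).
  rewrite -(per t 2); congr (expi (s * (t + _))); rewrite -[2%:~R]/(2 : R); ring.
have q1 : expi (s * (2 * pi)) = 1.
  by have := p1 0; rewrite add0r mulr0 expi0.
have q2 : expi (s * (4 * pi)) = 1.
  by have := p2 0; rewrite add0r mulr0 expi0.
by rewrite !p1 !p2 q1 q2; ring.
Qed.

Lemma ae_avoid (s : seq R) : {ae mu, forall t, t \notin s}.
Proof.
elim: s => [|a s IH]; first exact: aeW.
apply: (ae_imply2 (ae_neq a) IH) => t ta ts.
by rewrite inE negb_or ta.
Qed.

(** [(k, (a, b))] stands for the piece from [a + 2 * k * pi] to [b + 2 * k * pi] of the
    set. The intervals from [a] to [b] tile the interval from 0 to [2 * pi]. *)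
Definition residues : seq (int * (R * R)) :=
  [:: (0, (x, y)); (1, (0, 2 * x - 2 * pi)); (1, (2 * y - 2 * pi, x));
      (1, (y, 2 * pi)); (3, (2 * x - 2 * pi, 2 * y - 2 * pi))].

Lemma Kh_residue t : Kh t -> t \notin [seq p.1 | p <- pieces] ->
  exists2 p, p \in residues & p.2.1 < t - 2 * pi * p.1%:~R < p.2.2.
Proof.
move=> Kt; rewrite /= !inE !negb_or => /and5P[t1 t2 t3 t4 t5].
have lt a b : a <= t < b -> t != a -> a < t < b.
  by move=> /andP[at' ->] ta; rewrite lt_neqAle eq_sym ta at'.
case: Kt => [[[[|]|]|]|] /=; rewrite in_itv /= => /lt.
- move=> /(_ t1) /andP[a b]; exists (0, (x, y)); rewrite ?inE ?eqxx ?orbT//=.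
  by rewrite mulr0 subr0 a b.
- move=> /(_ t2) /andP[a b]; exists (1, (0, 2 * x - 2 * pi)); rewrite ?inE ?eqxx ?orbT//=.
  by rewrite mulr1; apply/andP; split; tlra.
- move=> /(_ t3) /andP[a b]; exists (1, (2 * y - 2 * pi, x)); rewrite ?inE ?eqxx ?orbT//=.
  by rewrite mulr1; apply/andP; split; tlra.
- move=> /(_ t4) /andP[a b]; exists (1, (y, 2 * pi)); rewrite ?inE ?eqxx ?orbT//=.
  by rewrite mulr1; apply/andP; split; tlra.
- move=> /(_ t5) /andP[a b]; exists (3, (2 * x - 2 * pi, 2 * y - 2 * pi)).
    by rewrite ?inE ?eqxx ?orbT.
  by rewrite /= -[3%:~R]/(3 : R); apply/andP; split; tlra.
Qed.

Lemma closed_residue t : (exists2 p, p \in pieces & p.1 <= t <= p.2) ->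
  exists2 p, p \in residues & p.2.1 <= t - 2 * pi * p.1%:~R <= p.2.2.
Proof.
move=> [p]; rewrite /pieces !inE => /orP[|/orP[|/orP[|/orP[|]]]] /eqP -> /= /andP[a b].
- exists (0, (x, y)); rewrite ?inE ?eqxx ?orbT//=.
  by rewrite mulr0 subr0 a b.
- exists (1, (0, 2 * x - 2 * pi)); rewrite ?inE ?eqxx ?orbT//=.
  by rewrite mulr1; apply/andP; split; tlra.
- exists (1, (2 * y - 2 * pi, x)); rewrite ?inE ?eqxx ?orbT//=.
  by rewrite mulr1; apply/andP; split; tlra.
- exists (1, (y, 2 * pi)); rewrite ?inE ?eqxx ?orbT//=.
  by rewrite mulr1; apply/andP; split; tlra.
- exists (3, (2 * x - 2 * pi, 2 * y - 2 * pi)).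
    by rewrite ?inE ?eqxx ?orbT.
  by rewrite /= -[3%:~R]/(3 : R); apply/andP; split; tlra.
Qed.

Lemma residues_disjoint p q z : p \in residues -> q \in residues ->
  p.2.1 < z < p.2.2 -> q.2.1 <= z <= q.2.2 -> p = q.
Proof.
by rewrite /residues !inE => /orP[|/orP[|/orP[|/orP[|]]]] /eqP -> 
  /orP[|/orP[|/orP[|/orP[|]]]] /eqP -> //= /andP[a b] /andP[c d]; exfalso; tlra.
Qed.

Lemma residues_bounds p : p \in residues -> 0 <= p.2.1 /\ p.2.2 <= 2 * pi.
Proof.
by rewrite /residues !inE => /orP[|/orP[|/orP[|/orP[|]]]] /eqP -> /=; split; tlra.
Qed.

(** Away from the endpoints, a point of [Kh] has its residue modulo [2 * pi] strictly
    between 0 and [2 * pi], and inside a single interval of [residues]. A congruent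
    point of the closure then has the same residue, so it lies in the same piece and
    is the same point. *)
Lemma Kh_separated : exp_separated Kh (2 * pi).
Proof.
pose C : set R := \big[setU/set0]_(p <- pieces) `[p.1, p.2]%classic.
have CP t : C t -> exists2 p, p \in pieces & p.1 <= t <= p.2.
  by rewrite /C -bigcup_seq => -[p /= pp]; rewrite in_itv; exists p.
apply: (@separated_compact _ _ C).
- move=> t; rewrite /C -bigcup_seq /=.
  case=> [[[[|]|]|]|] /=; rewrite in_itv /= => /andP[a /ltW b].
  + by exists (x, y); rewrite /= ?in_itv /= ?a ?b// /pieces !inE eqxx ?orbT.
  + by exists (2 * pi, 2 * x); rewrite /= ?in_itv /= ?a ?b// /pieces !inE eqxx ?orbT.
  + by exists (2 * y, x + 2 * pi); rewrite /= ?in_itv /= ?a ?b// /pieces !inE eqxx ?orbT.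
  + by exists (y + 2 * pi, 4 * pi); rewrite /= ?in_itv /= ?a ?b// /pieces !inE eqxx ?orbT.
  + by exists (2 * x + 4 * pi, 2 * y + 4 * pi); rewrite /= ?in_itv /= ?a ?b// /pieces !inE eqxx ?orbT.
- by apply: bigsetU_compact => p _; exact: segment_compact.
apply: (ae_imply (ae_avoid [seq p.1 | p <- pieces])) => t tP Kt z /CP zC.
rewrite divff ?gt_eqF// mul1r => /expi_eq1[k zt].
have [p pR tp] := Kh_residue Kt tP; have [q qR zq] := closed_residue zC.
have [p0 p1] := residues_bounds pR; have [q0 q1] := residues_bounds qR.
have kE : 2 * pi * (k + p.1 - q.1)%:~R = (z - t) + 2 * pi * p.1%:~R - 2 * pi * q.1%:~R :> R.
  by rewrite zt intrB intrD; ring.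
have m0 : k + p.1 - q.1 = 0.
  apply: (@int_small R); rewrite -(ltr_pM2l tau0) mulr1 -{1}(gtr0_norm tau0) -normrM ltr_norml.
  rewrite kE.
  by move: tp zq => /andP[? ?] /andP[? ?]; apply/andP; split; tlra.
have eqz : t - 2 * pi * p.1%:~R = z - 2 * pi * q.1%:~R.
  have : 2 * pi * (k + p.1 - q.1)%:~R = 0 :> R by rewrite m0 mulr0.
  by rewrite kE; tlra.
rewrite -eqz in zq; have pq := residues_disjoint pR qR tp zq.
by move: eqz; rewrite pq => /addIr.
Qed.

(** [(k, (a, b))] stands for the piece from [2 ^ k * a] to [2 ^ k * b] of the set. The
    intervals from [a] to [b] tile the interval from [x] to [2 * x], a fundamental
    domain of the half-line for the dilations by powers of 2. *)
Definition scales : seq (int * (R * R)) :=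
  [:: (0, (x, y)); (0, (2 * pi, 2 * x)); (1, (y, x / 2 + pi));
      (1, (y / 2 + pi, 2 * pi)); (2, (x / 2 + pi, y / 2 + pi))].

Lemma Kh_scale t : Kh t -> exists2 p, p \in scales & p.2.1 <= t / 2 ^ p.1 < p.2.2.
Proof.
case=> [[[[|]|]|]|] /=; rewrite in_itv /= => /andP[a b].
- by exists (0, (x, y)); rewrite ?inE ?eqxx ?orbT//= expr0z divr1 a b.
- by exists (0, (2 * pi, 2 * x)); rewrite ?inE ?eqxx ?orbT//= expr0z divr1 a b.
- exists (1, (y, x / 2 + pi)); rewrite ?inE ?eqxx ?orbT//= expr1z.
  by apply/andP; split; tlra.
- exists (1, (y / 2 + pi, 2 * pi)); rewrite ?inE ?eqxx ?orbT//= expr1z.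
  by apply/andP; split; tlra.
- exists (2, (x / 2 + pi, y / 2 + pi)); first by rewrite ?inE ?eqxx ?orbT.
  have -> : (2 : R) ^ (2, (x / 2 + pi, y / 2 + pi)).1 = 4 by rewrite /= -[2 ^ 2]/(2 ^+ 2) expr2; tlra.
  by rewrite /=; apply/andP; split; tlra.
Qed.

Lemma scale_Kh z p : p \in scales -> p.2.1 <= z < p.2.2 -> Kh (z * 2 ^ p.1).
Proof.
have e4 : (2 : R) ^ (2 : int) = 4 by rewrite -[2 ^ 2]/(2 ^+ 2) expr2; tlra.
rewrite /scales !inE => /orP[|/orP[|/orP[|/orP[|]]]] /eqP -> /= /andP[a b].
- by do 4 left; rewrite /= in_itv /= expr0z mulr1 a b.
- by do 3 left; right; rewrite /= in_itv /= expr0z mulr1 a b.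
- by do 2 left; right; rewrite /= in_itv /= expr1z; apply/andP; split; tlra.
- by left; right; rewrite /= in_itv /= expr1z; apply/andP; split; tlra.
- by right; rewrite /= in_itv /= e4; apply/andP; split; tlra.
Qed.

Lemma scales_bounds p : p \in scales -> x <= p.2.1 /\ p.2.2 <= 2 * x.
Proof.
by rewrite /scales !inE => /orP[|/orP[|/orP[|/orP[|]]]] /eqP -> /=; split; tlra.
Qed.

Lemma scales_disjoint p q z : p \in scales -> q \in scales ->
  p.2.1 <= z < p.2.2 -> q.2.1 <= z < q.2.2 -> p = q.
Proof.
by rewrite /scales !inE => /orP[|/orP[|/orP[|/orP[|]]]] /eqP -> 
  /orP[|/orP[|/orP[|/orP[|]]]] /eqP -> //= /andP[a b] /andP[c d]; exfalso; tlra.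
Qed.

Lemma scales_cover z : x <= z < 2 * x -> exists2 p, p \in scales & p.2.1 <= z < p.2.2.
Proof.
move=> /andP[xz zx].
have [zy|yz] := ltP z y.
  by exists (0, (x, y)); rewrite ?inE ?eqxx ?orbT//= xz zy.
have [z1|z1] := ltP z (x / 2 + pi).
  by exists (1, (y, x / 2 + pi)); rewrite ?inE ?eqxx ?orbT//= yz z1.
have [z2|z2] := ltP z (y / 2 + pi).
  by exists (2, (x / 2 + pi, y / 2 + pi)); rewrite ?inE ?eqxx ?orbT//= z1 z2.
have [z3|z3] := ltP z (2 * pi).
  by exists (1, (y / 2 + pi, 2 * pi)); rewrite ?inE ?eqxx ?orbT//= z2 z3.
by exists (0, (2 * pi, 2 * x)); rewrite ?inE ?eqxx ?orbT//= z3 zx.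
Qed.

Let two_neq0 : 2 != 0 :> R. Proof. by []. Qed.

(** Two points of a fundamental domain do not differ by a nontrivial dilation. *)
Lemma dyadic_unique (a : R) (m : int) : x <= a < 2 * x -> x <= a * 2 ^ m < 2 * x -> m = 0.
Proof.
move=> /andP[xa ax] /andP[xm mx].
have x0 : 0 < x by tlra.
have a0 : 0 < a by tlra.
have lt2 : (2 : R) ^ m < 2 ^ (1 : int).
  by rewrite expr1z -(ltr_pM2l a0); apply: lt_le_trans mx _; tlra.
have gt2 : (2 : R) ^ (- 1 : int) < 2 ^ m.
  rewrite -(ltr_pM2l a0) exprN1; apply: lt_le_trans xm; tlra.
rewrite ltr_eXz2l ?ltr1n// in lt2; rewrite ltr_eXz2l ?ltr1n// in gt2.
by case: m lt2 gt2 {xm mx} => [[|n]|n].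
Qed.

Lemma Kh_dilates_disjoint t (i j : int) : Kh (2 ^ i * t) -> Kh (2 ^ j * t) -> i = j.
Proof.
move=> Ki Kj; have [p pS tp] := Kh_scale Ki; have [q qS tq] := Kh_scale Kj.
have [p0 p1] := scales_bounds pS; have [q0 q1] := scales_bounds qS.
pose a := 2 ^ i * t / 2 ^ p.1.
have aE : 2 ^ j * t / 2 ^ q.1 = a * 2 ^ (j - q.1 - i + p.1).
  have h (k : int) : (2 : R) ^ k != 0 by rewrite expfz_neq0.
  rewrite /a !expfzDr// -!invr_expz.
  move: (2 ^ i) (2 ^ j) (2 ^ p.1) (2 ^ q.1) (h i) (h j) (h p.1) (h q.1).
  by move=> u v w z u0 v0 w0 z0; field; rewrite u0 w0 z0.
rewrite -/a in tp; rewrite aE in tq.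
have m0 : j - q.1 - i + p.1 = 0.
  by apply: (@dyadic_unique a); move: tp tq => /andP[? ?] /andP[? ?]; apply/andP; split; tlra.
rewrite m0 expr0z mulr1 in tq; have pq := scales_disjoint pS qS tp tq.
by move: m0; rewrite pq addrAC subrK => /eqP; rewrite subr_eq0 => /eqP.
Qed.

Lemma Kh_dilates_cover t : 0 < t -> exists j : int, Kh (2 ^ j * t).
Proof.
move=> t0; have x0 : 0 < x by tlra.
have ln2 : 0 < ln (2 : R) by rewrite ln_gt0// ltr1n.
pose m := Num.floor (ln (t / x) / ln 2).
have tx : 0 < t / x by exact: divr_gt0.
have /andP[m1 m2] := floor_itv (ln (t / x) / ln 2).
have pwE (k : int) : (2 : R) ^ k = expR (k%:~R * ln 2).
  by rewrite -powR_intmul// /powR (negbTE two_neq0).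
have z1 : (2 : R) ^ m <= t / x.
  by rewrite pwE -(@lnK _ (t / x)) ?posrE// ler_expR -ler_pdivlMr.
have z2 : t / x < (2 : R) ^ (m + 1).
  by rewrite pwE -(@lnK _ (t / x)) ?posrE// ltr_expR -ltr_pdivrMr.
have p0 : 0 < (2 : R) ^ m by rewrite exprz_gt0.
have zz : x <= 2 ^ (- m) * t < 2 * x.
  rewrite -invr_expz mulrC; apply/andP; split.
    by rewrite ler_pdivlMr// mulrC -ler_pdivlMr.
  rewrite ltr_pdivrMr//; move: z2; rewrite expfzDr// expr1z ltr_pdivrMr//.
  by rewrite -mulrA mulrC.
have [p pS zp] := scales_cover zz.
by exists (p.1 - m); have := scale_Kh pS zp; rewrite expfzDr// mulrC mulrA.
Qed.

(** * The wavelet basis *)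

Let ek (k : int) : R -> R[i] := ew Kh (2 * pi) k.

Let sek k : sqint (ek k).
Proof. exact: (sqint_ew (2 * pi) measurable_Kh finite_Kh). Qed.

Let ekE k t : ek k t = ind Kh t * expi (k%:~R * t).
Proof. by rewrite /ek /ew divff ?gt_eqF// mul1r. Qed.

Let amp (j : int) : R := 2 `^ (j%:~R / 2).

Let amp_gt0 j : 0 < amp j. Proof. exact: powR_gt0. Qed.

Let amp_sqr j : amp j * amp j = 2 ^ j.
Proof.
rewrite /amp -powRD; last by apply/implyP.
by rewrite -splitr powR_intmul.
Qed.

Let pow_gt0 (j : int) : 0 < (2 : R) ^ j. Proof. by rewrite exprz_gt0. Qed.

(** The Fourier transform of the dilate of index [jk]. The summand 0 makes it
    literally an affine change of variables in [ek]. *)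
Definition wavelet_hat (jk : int * int) (xi : R) : R[i] :=
  ((amp jk.1)^-1)%:C * ek (- jk.2) (2 ^ (- jk.1) * xi + 0).

Let wavelet : R -> R[i] := ift (ind Kh).

Lemma sqint_wavelet_hat jk : sqint (wavelet_hat jk).
Proof. by apply: sqintZ; exact: sqint_affine. Qed.

Lemma wavelet_hat_supported jk xi : ~ Kh (2 ^ (- jk.1) * xi) -> wavelet_hat jk xi = 0.
Proof. by move=> nK; rewrite /wavelet_hat addr0 ekE (ind0 nK) mul0r mulr0. Qed.

(** The change of variables eta = 2^(- j) xi in the inverse Fourier integral. *)
Lemma dilate_wavelet jk : dilate wavelet jk = ift (wavelet_hat jk).
Proof.
case: jk => j k; apply/funext => t; rewrite /dilate /wavelet /ift /=.
pose phi eta : R[i] := ((amp j)^-1)%:C * (ek (- k) eta * expi (2 ^ j * t * eta)).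
have iphi : cintegrable phi.
  apply: cintegrableZ; apply: cintegrable_unimodular; first exact: measurable_funM.
  have -> : ek (- k) = fun eta => ek (- k) eta * (ind Kh eta)^*.
    apply/funext => eta; rewrite !ekE; have [Ke|Ke] := pselect (Kh eta).
      by rewrite (ind1 Ke) rmorph1 mulr1.
    by rewrite (ind0 Ke) !mul0r.
  by apply: cintegrable_mulJ => //; exact: (sqint_ind measurable_Kh finite_Kh).
have -> : (fun xi => wavelet_hat (j, k) xi * expi (xi * t)) =
    (fun xi => phi (2 ^ (- j) * xi + 0)).
  apply/funext => xi; rewrite /phi /wavelet_hat /= -mulrA; congr (_ * (_ * expi _)).
  rewrite addr0 -invr_expz; have : (2 : R) ^ j != 0 by rewrite gt_eqF.
  by move: (2 ^ j) => z z0; field.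
rewrite cintegral_affine// -invr_expz invrK /phi.
rewrite cintegralZ; last first.
  by have := cintegrableZ (amp j)%:C iphi; congr cintegrable; apply/funext => eta;
    rewrite /phi mulrA -RC_M divff ?mul1r// gt_eqF.
have -> : (fun eta => ek (- k) eta * expi (2 ^ j * t * eta)) =
    (fun eta => ind Kh eta * expi (eta * (2 ^ j * t - k%:~R))).
  apply/funext => eta; rewrite ekE -mulrA -expiD; congr (_ * expi _).
  by rewrite rmorphN /=; ring.
rewrite mulrCA; congr (_ * _); rewrite mulrA -RC_M; congr (_%:C * _).
by rewrite -amp_sqr mulfK// gt_eqF.
Qed.

Lemma fourierL2_wavelet jk : fourierL2 (dilate wavelet jk) (wavelet_hat jk).
Proof.
rewrite dilate_wavelet; apply: (@fourierL2_ift _ (2 ^ jk.1 * (8 * pi))).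
- by rewrite mulr_gt0// mulr_gt0.
- exact: sqint_wavelet_hat.
- move=> xi nxi; apply: wavelet_hat_supported => Kxi; apply: nxi.
  have /andP[a b] := Kh_bounds Kxi; have c := Kh_gt0 Kxi.
  rewrite /= in_itv /=; move: b c; rewrite -invr_expz mulrC.
  rewrite ltr_pdivrMr// pmulr_lgt0 ?invr_gt0// => b c.
  rewrite [2 ^ _ * _]mulrC b andbT (le_trans _ (ltW c))// oppr_le0.
  by rewrite !mulr_ge0 ?ltW.
Qed.

Lemma wavelet_hat_orth i j : inner (wavelet_hat i) (wavelet_hat j) = (2 * pi)%:C * (i == j)%:R.
Proof.
case: i j => j k [j' k']; rewrite xpair_eqE.
have [->|jj'] := eqVneq j j'; last first.
  rewrite mulr0; rewrite /inner.
  have -> : (fun xi => wavelet_hat (j, k) xi * (wavelet_hat (j', k') xi)^*) = (fun=> 0).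
    apply/funext => xi; have [Kx|Kx] := pselect (Kh (2 ^ (- j) * xi)); last first.
      by rewrite wavelet_hat_supported// mul0r.
    rewrite [wavelet_hat (j', k') xi]wavelet_hat_supported ?rmorph0 ?mulr0//= => Kx'.
    by move: jj'; rewrite -eqr_opp (Kh_dilates_disjoint Kx Kx') eqxx.
  by apply: complex_ext; rewrite /= /Rintegral integral0.
rewrite innerZl ?innerZr; try exact: sqint_affine; try exact: sqintZ (sqint_affine _ _ _).
rewrite inner_affine// (Kh_orth (- k) (- k')) eqr_opp -invr_expz invrK.
rewrite conjcR /= mulrA -RC_M mulrA -RC_M -RC_M -amp_sqr.
have : amp j' != 0 by rewrite gt_eqF.
move: (amp j') => z z0.
by case: eqP => _ /=; rewrite ?mulr1 ?mulr0//; congr (_%:C); field.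
Qed.

(** Rescaling [2 ^ j Kh] to [Kh], this is the completeness of the exponentials on
    [Kh]. *)
Lemma in_span_dilate (g : R -> R[i]) j : sqint g ->
  in_span wavelet_hat (fun xi => ind Kh (2 ^ (- j) * xi) * g xi).
Proof.
move=> sg; pose h eta := ind Kh eta * g (2 ^ j * eta + 0).
have sh : sqint h.
  by apply: (sqint_cut measurable_Kh); exact: sqint_affine.
have hK eta : ~ Kh eta -> h eta = 0 by move=> nK; rewrite /h (ind0 nK) mul0r.
have hE : (fun xi => ind Kh (2 ^ (- j) * xi) * g xi) = (fun xi => h (2 ^ (- j) * xi + 0)).
  apply/funext => xi; rewrite /h !addr0 mulrA -expfzDr// subrr expr0z mul1r.
  by [].
have [_ H] := in_span_exponentials tau0 measurable_Kh finite_Kh Kh_orth Kh_separated sh hK.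
rewrite hE; split; first exact: sqint_affine.
move=> eps eps0; have [l hl] := H (eps / 2 ^ j) (divr_gt0 eps0 (pow_gt0 j)).
exists [seq ((amp j)%:C * p.1, (j, - p.2)) | p <- l].
have -> : (fun xi => h (2 ^ (- j) * xi + 0) -
      lcomb wavelet_hat [seq ((amp j)%:C * p.1, (j, - p.2)) | p <- l] xi) =
    (fun xi => (fun eta => h eta - lcomb ek l eta) (2 ^ (- j) * xi + 0)).
  apply/funext => xi; congr (_ - _); rewrite /lcomb big_map; apply: eq_bigr => p _.
  rewrite /wavelet_hat /= opprK mulrACA -RC_M divff ?gt_eqF// mul1r.
  by [].
rewrite (@nrm2_affine _ _ _ _ (fun eta => h eta - lcomb ek l eta))//.
  by rewrite -invr_expz invrK mulrC -ltr_pdivlMr.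
by apply: sqintB => //; exact: sqint_lcomb.
Qed.

(** A function on the half-line is the sum of its restrictions to the dilates of
    [Kh], and the sum converges in L2 by dominated convergence. *)
Lemma wavelet_hat_complete (g : R -> R[i]) : sqint g ->
  {ae mu, forall xi, xi <= 0 -> g xi = 0} -> in_span wavelet_hat g.
Proof.
move=> sg g0.
pose G n xi := \sum_(j <- idx n) ind Kh (2 ^ (- j) * xi) * g xi.
have eG n : in_span wavelet_hat (G n).
  by apply: in_span_sum => [|j]; [exact: sqint_wavelet_hat|exact: in_span_dilate].
have indS n xi : (exists2 j0, Kh (2 ^ (- j0) * xi) &
     \sum_(j <- idx n) ind Kh (2 ^ (- j) * xi) = (j0 \in idx n)%:R :> R[i]) \/
     (xi <= 0 /\ \sum_(j <- idx n) ind Kh (2 ^ (- j) * xi) = 0 :> R[i]).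
  have [xi0|xi0] := leP xi 0.
    right; split => //; rewrite big1// => j _; rewrite ind0// => /Kh_gt0.
    by rewrite pmulr_rgt0// ltNge xi0.
  left; have [m Km] := Kh_dilates_cover xi0; exists (- m); first by rewrite opprK.
  have ne j : j != - m -> ind Kh (2 ^ (- j) * xi) = 0 :> R[i].
    move=> jm; rewrite ind0// => Kj; move: jm.
    by rewrite -(Kh_dilates_disjoint Kj Km) opprK eqxx.
  have [mn|mn] := boolP (_ \in _).
    by rewrite (bigD1_seq (- m)) ?idx_uniq//= opprK (ind1 Km) big1 ?addr0.
  rewrite big1_seq// => j /andP[_ jn]; apply: ne.
  by apply: contraNneq mn => <-.
pose g' xi := ind `]0, +oo[ xi * g xi.
have sg' : sqint g' by apply: sqint_cut => //; exact: measurable_itv.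
have g'0 xi : xi <= 0 -> g' xi = 0.
  by move=> xi0; rewrite /g' ind0 ?mul0r//= in_itv /= andbT ltNge xi0.
have g'g xi : 0 < xi -> g' xi = g xi.
  by move=> xi0; rewrite /g' ind1 ?mul1r//= in_itv /= andbT.
have Kpos j0 xi : Kh (2 ^ (- j0) * xi) -> 0 < xi.
  by move=> /Kh_gt0; rewrite pmulr_rgt0.
have cG : (fun n => nrm2 (fun xi => G n xi - g' xi)) @ \oo --> (0 : R).
  apply: (@nrm2_dominated _ _ _ (fun xi => sq (g xi))).
  - by move=> n; have [[]] := eG n.
  - by case: sg'.
  - move=> xi; have [xi0|xi0] := leP xi 0.
      apply: (@cvgc_near _ _ _ 0%N) => n _; rewrite /G -mulr_suml g'0//.
      have [[j0 /Kpos]|[_ ->]] := indS n xi; last by rewrite mul0r.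
      by rewrite ltNge xi0.
    have [m Km] := Kh_dilates_cover xi0; have [N HN] := idx_cover [:: - m].
    apply: (@cvgc_near _ _ _ N) => n /HN mn; rewrite /G -mulr_suml g'g//.
    have [[j0 Kj0 ->]|[]] := indS n xi; last by rewrite leNgt xi0.
    have <- : - m = j0 by rewrite -(Kh_dilates_disjoint Kj0 Km) opprK.
    by rewrite mn ?mul1r// mem_head.
  - by case: sg.
  - move=> n xi; rewrite /G -mulr_suml.
    have [[j0 /Kpos xi0 ->]|[xi0 ->]] := indS n xi.
      rewrite g'g//; case: (_ \in _); first by rewrite mul1r subrr sq0 sq_ge0.
      by rewrite mul0r sub0r sqN.
    by rewrite g'0// mul0r subrr sq0 sq_ge0.
have nE n : nrm2 (fun xi => g xi - G n xi) = nrm2 (fun xi => G n xi - g' xi).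
  rewrite nrm2_swap /nrm2 /Rintegral; congr fine.
  have sGn : sqint (G n) by have [] := eG n.
  apply: ae_eq_integral => //.
  - by have [? _] := sqintB sGn sg; apply/measurable_EFinP; exact: measurable_sq.
  - by have [? _] := sqintB sGn sg'; apply/measurable_EFinP; exact: measurable_sq.
  apply: (ae_imply g0) => xi gxi _; have [xi0|xi0] := leP xi 0.
    by rewrite g'0// gxi.
  by rewrite g'g.
apply: (in_span_lim sqint_wavelet_hat) => // eps eps0.
have [N HN] := cvg0_eps cG eps0; exists (G N) => //.
by rewrite nE; exact: ltW (HN N (leqnn N)).
Qed.

Lemma H2_dilate jk : H2 (dilate wavelet jk).
Proof.
have H := fourierL2_wavelet jk; split; first by case: H.
exists (wavelet_hat jk); split => //; apply: aeW => xi xi0.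
apply: wavelet_hat_supported => /Kh_gt0.
by rewrite pmulr_rgt0// ltNge xi0.
Qed.

Lemma dilate00 : dilate wavelet (0, 0) = wavelet.
Proof.
apply/funext => t; rewrite /dilate /= mul0r powRr0 expr0z mul1r subr0.
by rewrite -[RHS]mul1r.
Qed.

(** The Plancherel identity carries orthogonality and approximation from the
    Fourier side; the constant [2 * pi] is the squared norm of [wavelet_hat jk]. *)
Lemma wavelet_basis : orthonormal_basis (@H2 R) (dilate wavelet).
Proof.
have sd jk : sqint (dilate wavelet jk) by apply/L2_sqint; case: (fourierL2_wavelet jk).
split; first exact: H2_dilate.
- move=> i j; have := fourierL2_inner (fourierL2_wavelet i) (fourierL2_wavelet j).
  rewrite wavelet_hat_orth => /mulfI -> //.
  by rewrite eq_complex /= gt_eqF.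
- move=> f [_ [g [fg g0]]] eps eps0.
  have [sf sg _] := (fourierL2P _ _).1 fg.
  have [_ H] := wavelet_hat_complete sg g0.
  have [|l gl] := H (2 * pi * eps ^+ 2); first by rewrite mulr_gt0// exprn_gt0.
  have := fourierL2B fg (fourierL2_lcomb l fourierL2_wavelet).
  move=> /fourierL2_plancherel nE; rewrite nE ltr_pM2l// in gl.
  have us := undup_uniq (map snd l).
  exists (undup (map snd l)), (fun i => \sum_(p <- l | p.2 == i) p.1).
  have lE : lcomb (dilate wavelet) l =
      comb (dilate wavelet) (undup (map snd l)) (fun i => \sum_(p <- l | p.2 == i) p.1).
    by apply: lcomb_comb => // p pl; rewrite mem_undup; exact: map_f.
  rewrite lE in gl.
  rewrite -/(comb _ _ _ _) L2norm_nrm2; last by apply: sqintB => //; exact: sqint_comb.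
  by rewrite lte_fin -(ltr_pXn2r (_ : (0 < 2)%N)) ?nnegrE ?sqrtr_ge0 ?ltW// sqr_sqrtr ?nrm2_ge0.
Qed.

(** [Kh] and [Kset x y] differ by right endpoints only, a null set. *)
Lemma Kset_wavelet_set : H2_wavelet_set (Kset x y).
Proof.
split.
- by do 4?[apply: measurableU].
- move=> t; rewrite /Kset /= !in_itv /= andbT.
  by move=> [[[[|]|]|]|] /andP[a b]; tlra.
exists wavelet; split.
  split; last exact: wavelet_basis.
  by rewrite -dilate00; exact: H2_dilate.
exists (ind Kh); split.
  have := fourierL2_wavelet (0, 0); rewrite dilate00; congr fourierL2.
  apply/funext => xi; rewrite /wavelet_hat /= /amp mul0r powRr0 invr1 mul1r.
  by rewrite oppr0 expr0z mul1r addr0 ekE mul0r expi0 mulr1.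
apply: (ae_imply (ae_avoid [seq p.2 | p <- pieces])) => t tP.
have [t1 t2 t3 t4 t5] : [/\ t != y, t != 2 * x, t != x + 2 * pi, t != 4 * pi
    & t != 2 * y + 4 * pi].
  by move: tP; rewrite /= !inE !negb_or => /and5P.
have eqI (a b : R) : t != b -> `[a, b[%classic t <-> `[a, b]%classic t.
  by move=> tb; rewrite /= !in_itv /= [t < b]lt_neqAle tb.
have KK : Kh t <-> Kset x y t.
  rewrite /Kh /Kset; split.
    by case=> [[[[|]|]|]|] /eqI h; [do 4 left|do 3 left; right|do 2 left; right|left; right|right]; exact: h.
  by case=> [[[[|]|]|]|] h; [do 4 left|do 3 left; right|do 2 left; right|left; right|right]; exact/eqI.
rewrite normc_sq; have [Kt|Kt] := pselect (Kh t).
  by rewrite (ind1 Kt) sq1 sqrtr1 indicE mem_set//; exact/KK.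
by rewrite (ind0 Kt) sq0 sqrtr0 indicE memNset// => /KK.
Qed.
End wavelet_set.

Theorem mainTheorem5 (R : realType) (x y : R)
  (hpx : pi < x) (hxy : x < y) (hy : y < 2 * pi) (hgap : 2 * y < x + 2 * pi) :
  H2_wavelet_set (Kset x y).
Proof. exact: Kset_wavelet_set. Qed.
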